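(* Let $G$ be a locally compact second countable group with Haar measure $m$. If $\mu$ is a spread-out probability measure on $G$, then there exists a probability measure $\mu'$ on $G$ which is absolutely continuous with respect to $m$ and has bounded density with respect to $m$ such that $\Gamma(G,\mu)=\Gamma(G,\mu')$.
   Context: **Spread-out.** A probability measure $\mu$ on $G$ is spread-out if there exists $n\ge 1$ such that the convolution power $\mu^{*n}$ is not singular with respect to the Haar measure $m$. **Random walk and path space.** For a probability measure $\mu$ on $G$ (with identity $e$), the random walk $(G,\mu)$ is the Markov chain on $G$ whose position at time $n$ is $x_n=h_1h_2\cdots h_n$, where the increments $h_i$ are i.i.d. with law $\mu$. The measure $\mathbf{P}=\mathbf{P}_\mu$ on the path space $G^\infty$ is the image of the Bernoulli measure $\mu^{\infty}$ under the map $(h_1,h_2,\dots)\mapsto (e,x_1,x_2,\dots)$. **Poisson boundary.** Let $S$ be the left shift on the path space. Two paths $\bar x,\bar x'$ are equivalent if there exist natural numbers $m,n$ with $S^m\bar x=S^n\bar x'$. The $\sigma$-algebra $\mathcal{A}$ corresponding to this equivalence relation (the measurable sets that are, modulo $\mathbf{P}$-null sets, unions of equivalence classes) is called the Poisson $\sigma$-algebra. By Rokhlin's theorem there exist a unique (mod $0$) measurable space $\Gamma=\Gamma(G,\mu)$ with $\sigma$-algebra $\sigma(\Gamma)$ and a measurable map $\mathbf{bnd}:G^\infty\to\Gamma$ such that $\mathcal{A}=\mathbf{bnd}^{-1}(\sigma(\Gamma))$. The space $\Gamma$ is equipped with the harmonic measure $\nu=\mathbf{bnd}(\mathbf{P})$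 (the image measure), and $(\Gamma,\nu)$ is the Poisson boundary of $(G,\mu)$ (the space of ergodic components of $S$). The equality $\Gamma(G,\mu)=\Gamma(G,\mu')$ means that the two Poisson boundaries coincide as measure spaces. *)

(* Defs.v *)
(* Library: MathComp-Analysis. *)
From HB Require Import structures.
From mathcomp Require Import all_boot all_order all_algebra.
From mathcomp Require Import all_classical all_reals all_analysis.

Set Implicit Arguments.
Unset Strict Implicit.
Unset Printing Implicit Defensive.

Import Order.TTheory GRing.Theory Num.Theory.
Import numFieldNormedType.Exports.

Local Open Scope classical_set_scope.
Local Open Scope ring_scope.

HB.mixin Record Group_isTopological G of Group G & PointedTopological G := {
  mulg_continuous : continuous (fun p : G * G => (p.1 * p.2)%g) ;
  invg_continuous : continuous (fun x : G => (x^-1)%g)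
}.

(* The distinguished point is only there because the library's measurable
   types are pointed; it need not be the identity and plays no role. *)
#[short(type="topologicalGroupType")]
HB.structure Definition TopologicalGroup :=
  {G of Group G & PointedTopological G & Group_isTopological G}.

Definition borel (T : ptopologicalType) : measurableType _ :=
  g_sigma_algebraType (@open T).

(* T^oo with the product sigma-algebra, generated by the coordinates. *)
Definition cylinders d (T : measurableType d) : set (set (nat -> T)) :=
  [set A | exists n : nat,
     exists2 B : set T, measurable B & A = [set x | B (x n)]].

Definition seqspace d (T : measurableType d) : measurableType _ :=
  g_sigma_algebraType (@cylinders d T).

Section measures_on_groups.
Context (R : realType) (G : topologicalGroupType).
Local Open Scope ereal_scope.

(* Left Haar measure. *)
Definition is_haar (m : {measure set (borel G) -> \bar R}) : Prop :=
  [/\ m setT != 0,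
      forall K : set G, compact K -> m K < +oo &
      forall (x : G) (B : set (borel G)), measurable B ->
        m [set y : G | B (x * y)%g] = m B].

Definition convolution (mu nu : set (borel G) -> \bar R) :
    set (borel G) -> \bar R :=
  fun B => \int[mu]_x nu [set y : G | B ((x : G) * y)%g].

Fixpoint convolution_power (mu : set (borel G) -> \bar R) (n : nat) :
    set (borel G) -> \bar R :=
  if n is n'.+1 then convolution mu (convolution_power mu n')
  else \d_(1%g : borel G).

Definition singular (nu m : set (borel G) -> \bar R) : Prop :=
  exists2 A : set (borel G), measurable A & m A = 0 /\ nu (~` A) = 0.

Definition spread_out (m : {measure set (borel G) -> \bar R})
    (mu : probability (borel G) R) : Prop :=
  exists2 n : nat, (1 <= n)%N & ~ singular (convolution_power mu n) m.

Definition has_bounded_density (m : {measure set (borel G) -> \bar R})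
    (mu : probability (borel G) R) : Prop :=
  exists (f : borel G -> R) (C : R),
    [/\ measurable_fun setT f,
        forall x, (0 <= f x <= C)%R &
        forall B, measurable B -> mu B = \int[m]_(x in B) (f x)%:E].

End measures_on_groups.

Section random_walk.
Context (R : realType) (G : topologicalGroupType).
Local Open Scope ereal_scope.

(* Q = mu^oo; the cylinder formula determines Q. *)
Definition is_bernoulli (mu : probability (borel G) R)
    (Q : probability (seqspace (borel G)) R) : Prop :=
  forall (n : nat) (B : nat -> set (borel G)),
    (forall i, measurable (B i)) ->
    Q [set h | forall i, (i < n)%N -> B i (h i)] = \prod_(i < n) mu (B i).

(* walk g h n = g h_1 ... h_n; the increment h_(n+1) is stored as h n. *)
Fixpoint walk (g : G) (h : nat -> G) (n : nat) : G :=
  if n is n'.+1 then (walk g h n' * h n')%g else g.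

(* Law of the trajectory issued from g; the measure P of the random walk is
   the case g = 1. *)
Definition path_law (Q : probability (seqspace (borel G)) R) (g : G) :
    set (seqspace (borel G)) -> \bar R :=
  pushforward Q (walk g : seqspace (borel G) -> seqspace (borel G)).

Definition shift (n : nat) (x : nat -> G) : nat -> G := fun k => x (k + n)%N.

Definition path_equiv (x y : nat -> G) : Prop :=
  exists m n : nat, shift m x = shift n y.

Definition saturated (A : set (nat -> G)) : Prop :=
  forall x y, path_equiv x y -> A x -> A y.

Definition poisson_salgebra (P : set (seqspace (borel G)) -> \bar R) :
    set (set (seqspace (borel G))) :=
  [set A | measurable A /\
     exists2 A0 : set (seqspace (borel G)), measurable A0 &
       saturated A0 /\ P (A `+` A0) = 0].

(* Measurable spaces that are Borel isomorphic to a Borel subset of the line: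
   the point spaces to which Rokhlin's correspondence between sub-sigma-algebras
   and quotients applies. *)
Definition standard_borel d (T : measurableType d) : Prop :=
  exists f : T -> R,
    [/\ measurable_fun setT f, injective f &
        forall A, measurable A -> measurable (f @` A)].

(* The Poisson sigma-algebra is bnd^-1(sigma(Gamma)) modulo P-null sets. *)
Definition is_poisson_boundary (Q : probability (seqspace (borel G)) R)
    d (Gamma : measurableType d) (bnd : seqspace (borel G) -> Gamma) : Prop :=
  let P := path_law Q 1%g in
  [/\ standard_borel Gamma,
      measurable_fun setT bnd &
      forall A : set (seqspace (borel G)),
        poisson_salgebra P A <->
        measurable A /\
        exists2 B : set Gamma, measurable B & P (A `+` (bnd @^-1` B)) = 0].

(* Image of the law of the walk issued from g; for g = 1 it is the harmonic
   measure nu. *)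
Definition harmonic_measure (Q : probability (seqspace (borel G)) R)
    d (Gamma : measurableType d) (bnd : seqspace (borel G) -> Gamma) (g : G) :
    set Gamma -> \bar R :=
  pushforward (path_law Q g) bnd.

(* One measure space (Gamma, nu) is the Poisson boundary of both walks; at
   g = 1 the last clause says that both harmonic measures are nu. Any two
   non-atomic standard probability spaces are isomorphic, so the equality is
   asked for the walks issued from every g, which makes the identification
   respect the group. The boundary maps are constant on equivalence classes of
   paths because harmonic measures of other starting points would otherwise
   depend on their values on P-null sets. *)
Definition same_poisson_boundary (mu mu' : probability (borel G) R) : Prop :=
  exists (Q Q' : probability (seqspace (borel G)) R)
         (d : measure_display) (Gamma : measurableType d)
         (bnd bnd' : seqspace (borel G) -> Gamma),
    [/\ is_bernoulli mu Q /\ is_bernoulli mu' Q',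
        is_poisson_boundary Q bnd /\ is_poisson_boundary Q' bnd',
        forall x y, path_equiv x y -> bnd x = bnd y /\ bnd' x = bnd' y &
        forall (g : G) (B : set Gamma), measurable B ->
          harmonic_measure Q bnd g B = harmonic_measure Q' bnd' g B].

End random_walk.

(* Main.v *)
Require Import Defs.
From HB Require Import structures.
From mathcomp Require Import all_boot all_order all_algebra.
From mathcomp Require Import all_classical all_reals all_analysis.
From mathcomp Require Import measurable_realfun.
From mathcomp Require Import ring lra.

Set Implicit Arguments.
Unset Strict Implicit.
Unset Printing Implicit Defensive.

Import Order.TTheory GRing.Theory Num.Theory.
Import numFieldNormedType.Exports.

Local Open Scope classical_set_scope.
Local Open Scope ring_scope.

(* The Poisson boundary is determined by the bounded harmonic functions. Let mu
   and mu' have the same ones. For a shift-invariant event A the function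
   phi_A(g) = P_g(A) is harmonic, and by martingale convergence it tends to 1_A
   along mu-almost every path. It converges along the mu'-paths too, and its
   limit there is 0 or 1: min(phi_A, 1 - phi_A) is superharmonic for mu', and the
   limit of its iterates is a mu'-harmonic, hence mu-harmonic, minorant, which
   vanishes because the minimum tends to 0 along the mu-paths. So the event
   {lim phi_A = 1} represents A for mu and has the same probability phi_A(g) for
   the two walks. Countably many such events, coded in ternary, give one boundary
   map that serves both walks.

   To produce mu', let theta = sum_(n >= 1) 2^-n mu^{*n}. It has the same bounded
   harmonic functions as mu and is not singular, so theta = al + be with al
   nonzero and al <= C m. The solution mu' = sum_k be^{*k} * al of the equation
   mu' = al + be * mu' satisfies mu' <= C / al(G) m by left invariance of m, and
   has the same bounded harmonic functions as theta because be has mass < 1. *)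

(** * Integrals of bounded measurable functions *)

(** The path measures of the two walks may be mutually singular, so a null set of one says nothing
    about the other. The only data they share are harmonic functions, and every transfer has to pass
    through one; this is why minima, which are merely superharmonic, are iterated to a limit. The
    boundary map must give equal harmonic measures on all Borel sets and from all starting points,
    so moving events one by one is not enough: the events that behave well for both walks are shown
    to form a sigma-algebra, and only then do countably many of them control the whole map.

    Replacing mu by theta is forced: only some unknown power is non-singular, and a single power can
    have more harmonic functions than mu. Both changes of measure solve the same equation rho = al +
    be * rho. With al = be = mu/2 the solution is theta; with the splitting of theta it is mu'.
    Convolving by be on the left is what lets left invariance of m bound each term of the series,
    and 1 / al(G) is the geometric sum of the masses of the be^{*k}. *)

Section bounded_measurable.
Context (R : realType) d (T : measurableType d).
Implicit Types f g : T -> R.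

(** For this class and a finite measure integrability is automatic, so the probabilistic part can
    compute with real-valued integrals. *)
Definition bounded_mfun f :=
  measurable_fun setT f /\ exists M : R, forall x, `|f x| <= M.

Lemma bounded_mfun_cst (c : R) : bounded_mfun (fun=> c).
Proof. by split=> //; exists `|c|. Qed.

Lemma bounded_mfunN f : bounded_mfun f -> bounded_mfun (fun x => - f x).
Proof.
move=> [mf [M fM]]; split; first exact: measurable_funN.
by exists M => x; rewrite normrN.
Qed.

Lemma bounded_mfunD f g : bounded_mfun f -> bounded_mfun g ->
  bounded_mfun (fun x => f x + g x).
Proof.
move=> [mf [M fM]] [mg [N gN]]; split; first exact: measurable_funD.
by exists (M + N) => x; rewrite (le_trans (ler_normD _ _))// lerD.
Qed.

Lemma bounded_mfunB f g : bounded_mfun f -> bounded_mfun g ->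
  bounded_mfun (fun x => f x - g x).
Proof. by move=> bf bg; apply: bounded_mfunD => //; exact: bounded_mfunN. Qed.

Lemma bounded_mfunM f g : bounded_mfun f -> bounded_mfun g ->
  bounded_mfun (fun x => f x * g x).
Proof.
move=> [mf [M fM]] [mg [N gN]]; split; first exact: measurable_funM.
by exists (M * N) => x; rewrite normrM ler_pM.
Qed.

Lemma bounded_mfunZ (c : R) f : bounded_mfun f -> bounded_mfun (fun x => c * f x).
Proof. by move=> bf; apply: bounded_mfunM => //; exact: bounded_mfun_cst. Qed.

Lemma bounded_mfun_norm f : bounded_mfun f -> bounded_mfun (fun x => `|f x|).
Proof.
move=> [mf [M fM]]; split; first exact: measurableT_comp.
by exists M => x; rewrite normr_id.
Qed.

Lemma bounded_mfun_min f g : bounded_mfun f -> bounded_mfun g ->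
  bounded_mfun (fun x => Num.min (f x) (g x)).
Proof.
move=> [mf [M fM]] [mg [N gN]]; split; first exact: measurable_minr.
exists (M + N) => x; have := fM x; have := gN x.
by rewrite /Num.min; case: ifP; have := normr_ge0 (f x); have := normr_ge0 (g x); lra.
Qed.

Lemma bounded_mfun_indic (A : set T) : measurable A ->
  bounded_mfun (\1_A : T -> R).
Proof.
move=> mA; split; first exact: measurable_indic.
by exists 1 => x; rewrite indicE; case: (_ \in _); rewrite ?normr0 ?normr1.
Qed.

End bounded_measurable.

Lemma bounded_mfun_comp (R : realType) d d' (T : measurableType d)
    (S : measurableType d') (phi : S -> T) (f : T -> R) :
  measurable_fun setT phi -> bounded_mfun f -> bounded_mfun (f \o phi).
Proof.
move=> mphi [mf [M fM]]; split; first exact: measurableT_comp.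
by exists M => x; exact: fM.
Qed.

Section bounded_integral.
Context (R : realType) d (T : measurableType d)
  (mu : {finite_measure set T -> \bar R}).
Implicit Types f g : T -> R.

Lemma bounded_mfun_integrable f : bounded_mfun f ->
  mu.-integrable setT (EFin \o f).
Proof.
move=> [mf [M fM]]; apply: measurable_bounded_integrable => //.
  by rewrite ltey_eq fin_num_measure.
exists M; split; first exact: num_real.
by move=> N MN x _ /=; rewrite (le_trans (fM x))// ltW.
Qed.

Lemma Rint_EFin f : bounded_mfun f ->
  (\int[mu]_x f x)%:E = (\int[mu]_x (f x)%:E)%E.
Proof.
move=> /bounded_mfun_integrable fi; rewrite fineK//.
exact: integrable_fin_num.
Qed.

Lemma RintD f g : bounded_mfun f -> bounded_mfun g ->
  \int[mu]_x (f x + g x) = \int[mu]_x f x + \int[mu]_x g x.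
Proof. by move=> bf bg; rewrite RintegralD//; exact: bounded_mfun_integrable. Qed.

Lemma RintB f g : bounded_mfun f -> bounded_mfun g ->
  \int[mu]_x (f x - g x) = \int[mu]_x f x - \int[mu]_x g x.
Proof. by move=> bf bg; rewrite RintegralB//; exact: bounded_mfun_integrable. Qed.

Lemma RintZ (c : R) f : bounded_mfun f ->
  \int[mu]_x (c * f x) = c * \int[mu]_x f x.
Proof. by move=> bf; rewrite RintegralZl//; exact: bounded_mfun_integrable. Qed.

Lemma le_Rint f g : bounded_mfun f -> bounded_mfun g ->
  (forall x, f x <= g x) -> \int[mu]_x f x <= \int[mu]_x g x.
Proof.
by move=> bf bg fg; apply: le_Rintegral => //; exact: bounded_mfun_integrable.
Qed.

Lemma Rint_cst (c : R) : \int[mu]_x c = c * fine (mu setT).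
Proof. by rewrite Rintegral_cst. Qed.

Lemma Rint_indic (A : set T) : measurable A ->
  \int[mu]_x \1_A x = fine (mu A).
Proof. by move=> mA; rewrite /Rintegral integral_indic// setIT. Qed.

Lemma Rint_indicE (A : set T) : measurable A ->
  (\int[mu]_x \1_A x)%:E = mu A.
Proof. by move=> mA; rewrite Rint_indic// fineK// fin_num_measure. Qed.

Lemma eq_Rint f g : f =1 g -> \int[mu]_x f x = \int[mu]_x g x.
Proof. by move=> fg; apply: eq_Rintegral => x _. Qed.

Lemma ae_eq_Rint f g : bounded_mfun f -> bounded_mfun g ->
  (\forall x \ae mu, f x = g x) -> \int[mu]_x f x = \int[mu]_x g x.
Proof.
move=> [mf _] [mg _] fg; congr fine; apply: ae_eq_integral => //.
- exact/measurable_EFinP.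
- exact/measurable_EFinP.
- by apply: filterS fg => x ->.
Qed.

Lemma Rint_eq0_ae f : bounded_mfun f -> (forall x, 0 <= f x) ->
  \int[mu]_x f x = 0 -> \forall x \ae mu, f x = 0.
Proof.
move=> bf f0 If0.
have : ae_eq mu setT (EFin \o f) (cst 0%E).
  apply/(ae_eq_integral_abs mu measurableT).
    by apply/measurable_EFinP; case: bf.
  transitivity (\int[mu]_x (f x)%:E)%E; last by rewrite -Rint_EFin// If0.
  by apply: eq_integral => x _; rewrite /= ger0_norm.
by apply: filterS => x /(_ I) [].
Qed.

Lemma bounded_cvg_Rint (f_ : (T -> R)^nat) f (M : R) :
  (forall n, measurable_fun setT (f_ n)) -> (forall n x, `|f_ n x| <= M) ->
  bounded_mfun f -> (\forall x \ae mu, f_ ^~ x @ \oo --> f x) ->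
  (\int[mu]_x f_ n x) @[n --> \oo] --> \int[mu]_x f x.
Proof.
move=> mf_ f_M bf f_f.
have bf_ n : bounded_mfun (f_ n) by split => //; exists M.
apply: fine_cvg; rewrite Rint_EFin//.
have [] := @dominated_convergence _ _ _ mu setT measurableT
  (fun n => EFin \o f_ n) (EFin \o f) (cst M%:E).
- by move=> n; apply/measurable_EFinP.
- by apply/measurable_EFinP; case: bf.
- by apply: filterS f_f => x f_f _; apply: cvg_EFin => //; exact: nearW.
- exact: (bounded_mfun_integrable (bounded_mfun_cst _ _)).
- by apply: aeW => x n _ /=; rewrite lee_fin.
by [].
Unshelve. all: by end_near. Qed.

End bounded_integral.

Section fubini.
Context (R : realType) d1 d2 (T1 : measurableType d1) (T2 : measurableType d2).

Lemma bounded_mfun_pair1 (f : T1 * T2 -> R) x :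
  bounded_mfun f -> bounded_mfun (fun y => f (x, y)).
Proof.
move=> [mf [M fM]]; split; last by exists M.
by apply: (@measurableT_comp _ _ _ _ _ _ f) => //.
Qed.

Lemma bounded_mfun_Rint (m : {finite_measure set T2 -> \bar R})
  (f : T1 * T2 -> R) : bounded_mfun f -> bounded_mfun (fun x => \int[m]_y f (x, y)).
Proof.
move=> bf; have [mf [M fM]] := bf; have f1 x := bounded_mfun_pair1 x bf.
split; last first.
  exists (M * fine (m setT)) => x.
  rewrite (le_trans (le_normr_Rintegral _ _))//.
    exact: bounded_mfun_integrable.
  rewrite -Rint_cst; apply: le_Rint => //.
    have [mfx [N fN]] := f1 x; split; first exact: measurableT_comp.
    by exists N => y; rewrite normr_id.
  exact: bounded_mfun_cst.
(* Adding the bound [M] makes the integrand nonnegative, as Tonelli's measurability statement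
   requires. *)
rewrite (_ : (fun x => _) = (fun x => \int[m]_y (f (x, y) + M) - \int[m]_y M)).
  apply: measurable_funB => //.
  apply: (@measurableT_comp _ _ _ _ _ _ fine) => //.
  apply: (@measurable_fun_fubini_tonelli_F _ _ _ _ _ m (fun z => (f z + M)%:E)) => //.
    by apply/measurable_EFinP; exact: measurable_funD.
  by move=> z; rewrite lee_fin -lerBlDr sub0r lerNl (le_trans _ (fM z))// -normrN ler_norm.
apply/funext => x; rewrite RintD ?addrK//.
exact: bounded_mfun_cst.
Qed.

Lemma bounded_Fubini (m1 : {finite_measure set T1 -> \bar R})
  (m2 : {finite_measure set T2 -> \bar R}) (f : T1 * T2 -> R) : bounded_mfun f ->
  (\int[m1]_x \int[m2]_y f (x, y))%R = fine (\int[m1 \x m2]_z (f z)%:E)%E.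
Proof.
move=> bf; have [mf [M fM]] := bf; have f1 x := bounded_mfun_pair1 x bf.
rewrite /Rintegral; congr fine.
rewrite -(@integral12_prod_meas1 _ _ _ _ _ m1 m2 (EFin \o f)).
  by apply: eq_integral => x _; rewrite Rint_EFin.
apply: measurable_bounded_integrable => //.
  rewrite (_ : _ setT = (m1 setT * m2 setT)%E) ?lte_mul_pinfty ?ltey_eq ?fin_num_measure//.
  by rewrite -product_measure1E// setXTT.
exists M; split; first exact: num_real.
by move=> N MN x _ /=; rewrite (le_trans (fM x))// ltW.
Qed.

End fubini.

(** * Sequence spaces and walks *)

Section sequence_space.
Context d (T : measurableType d).

Lemma measurable_coord n : measurable_fun setT (fun x : seqspace T => (x : nat -> T) n).
Proof.
move=> _ B mB; rewrite setTI; apply: sub_sigma_algebra; exists n; exists B => //.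
Qed.

Lemma measurable_fun_seqspace d' (S : measurableType d') (f : S -> seqspace T) :
  (forall n, measurable_fun setT (fun s => (f s : nat -> T) n)) ->
  measurable_fun setT f.
Proof.
move=> mf; apply: (@measurability _ _ _ (seqspace T) _ _ (@cylinders _ T)) => //.
move=> _ [_ [n [B mB ->]] <-].
exact: (mf n measurableT B mB).
Qed.

Definition scons (y : T) (x : nat -> T) : nat -> T :=
  fun n => if n is n'.+1 then x n' else y.

Lemma measurable_scons d' (S : measurableType d') (f : S -> T)
    (g : S -> seqspace T) : measurable_fun setT f -> measurable_fun setT g ->
  measurable_fun setT (fun s => scons (f s) (g s) : seqspace T).
Proof.
move=> mf mg; apply: measurable_fun_seqspace => -[|n] //=.
exact: (measurableT_comp (measurable_coord n) mg).
Qed.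

Lemma measurable_scons1 y : measurable_fun setT (scons y : seqspace T -> seqspace T).
Proof. exact: (@measurable_scons _ (seqspace T) (fun=> y) id). Qed.

End sequence_space.

(** * Borel measurability of the group law and of walks *)

Section second_countable_group.
Context (G : topologicalGroupType) (G_second_countable : @second_countable G).

Lemma countable_base : exists U : nat -> set G, (forall n, open (U n)) /\
  forall W x, open W -> W x -> exists n, U n x /\ U n `<=` W.
Proof.
have [B cB [Bopen Bbase]] := G_second_countable.
have [f finj] := countable_injP _ cB.
(* [f] is injective on the base, so this union has at most one member; indices that are not attained
   give the empty set. *)
exists (fun n => \bigcup_(V in [set V | B V /\ f V = n]) V); split.
  by move=> n; apply: bigcup_open => V [BV _]; exact: Bopen.
move=> W x oW Wx; have [V [BV Vx] VW] := Bbase x W (open_nbhs_nbhs (conj oW Wx)).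
exists (f V); split; first by exists V.
by move=> y [V' [BV' fV'] V'y]; apply: VW; rewrite -(finj V' V) ?inE.
Qed.

Lemma borel_open (W : set G) : open W -> measurable (W : set (borel G)).
Proof. by move=> oW; exact: sub_sigma_algebra. Qed.

(** The source carries the product sigma-algebra, so continuity alone does not suffice: second
    countability turns the preimage of an open set into a countable union of open rectangles. *)
Lemma measurable_mulg :
  measurable_fun setT (fun p : borel G * borel G => ((p.1 : G) * p.2)%g : borel G).
Proof.
apply: (@measurability _ _ _ (borel G) _ _ (@open G)) => // _ [W oW <-].
have [U [oU Ubase]] := countable_base.
pose I := [set ij : nat * nat |
  U ij.1 `*` U ij.2 `<=` (fun p : G * G => (p.1 * p.2)%g) @^-1` W].
rewrite (_ : _ `&` _ = \bigcup_(ij in I) (U ij.1 `*` U ij.2)).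
  rewrite bigcup_mkcond; apply: countable_bigcupT_measurable => //= -[i j].
  case: ifP => // _.
  by apply: measurableX; exact: borel_open.
rewrite setTI; apply/seteqP; split => [[x y] /= Wxy|[x y] [ij Iij Uxy]]; last exact: Iij.
have : nbhs (x, y) ((fun p : G * G => (p.1 * p.2)%g) @^-1` W).
  by apply: (@mulg_continuous G (x, y)); exact: open_nbhs_nbhs.
move=> [[A B] [/= /nbhs_interior Ax /nbhs_interior By] AB].
have [i [Uix UiA]] := Ubase _ x (@open_interior _ A) (nbhs_singleton Ax).
have [j [Ujy UjB]] := Ubase _ y (@open_interior _ B) (nbhs_singleton By).
exists (i, j) => // -[x' y'] /= [/UiA/interior_subset Ax' /UjB/interior_subset By'].
exact: (AB (x', y')).
Qed.

Lemma measurable_mulgl (g : G) :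
  measurable_fun setT (fun x : borel G => (g * x)%g : borel G).
Proof.
exact: (measurableT_comp measurable_mulg
  (@pair1_measurable _ _ (borel G) (borel G) g)).
Qed.

Lemma measurable_walk : measurable_fun setT
  (fun p : borel G * seqspace (borel G) => walk p.1 p.2 : seqspace (borel G)).
Proof.
apply: measurable_fun_seqspace; elim=> [|n IHn] /=; first exact: measurable_fst.
have mp : measurable_fun setT (fun p : borel G * seqspace (borel G) =>
    (walk p.1 p.2 n : borel G, p.2 n : borel G)).
  apply/measurable_fun_pair => //.
  exact: (measurableT_comp (measurable_coord n) measurable_snd).
exact: (measurableT_comp measurable_mulg mp).
Qed.

Lemma measurable_walk1 (g : G) : measurable_fun setT
  (walk g : seqspace (borel G) -> seqspace (borel G)).
Proof.
exact: (measurableT_comp measurable_walk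
  (@pair1_measurable _ _ (borel G) (seqspace (borel G)) g)).
Qed.

Lemma measurable_shift n :
  measurable_fun setT (Defs.shift n : seqspace (borel G) -> seqspace (borel G)).
Proof. by apply: measurable_fun_seqspace => k; exact: measurable_coord. Qed.

End second_countable_group.

Section walk_equations.
Context (G : topologicalGroupType).
Implicit Types (g : G) (h : nat -> G).

Lemma walk_scons g (y : borel G) h n : walk g (scons y h) n.+1 = walk (g * y)%g h n.
Proof. by elim: n => //= n ->. Qed.

Lemma walk_sconsE g (y : borel G) h :
  walk g (scons y h) = scons (g : borel G) (walk (g * y)%g h).
Proof. by apply/funext => -[//|n]; rewrite walk_scons. Qed.

End walk_equations.

(** * Bernoulli measures *)

Lemma le_cvgn (R : realType) (u v : nat -> R) (l l' : R) :
  u @ \oo --> l -> v @ \oo --> l' -> (forall n, u n <= v n) -> l <= l'.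
Proof. by move=> ul vl' uv; apply: (ler_cvg_to ul vl'); exact: nearW. Qed.

Lemma cvgn_ge (R : realType) (u : nat -> R) (l c : R) :
  u @ \oo --> l -> (forall n, c <= u n) -> c <= l.
Proof. by move=> ul; apply: (le_cvgn (cvg_cst c) ul). Qed.

Lemma cvgn_le (R : realType) (u : nat -> R) (l c : R) :
  u @ \oo --> l -> (forall n, u n <= c) -> l <= c.
Proof. by move=> ul; apply: (le_cvgn ul (cvg_cst c)). Qed.

Lemma cvgn_uniq (R : realType) (u : nat -> R) (l l' : R) :
  u @ \oo --> l -> u @ \oo --> l' -> l = l'.
Proof. by move=> ul ul'; apply: (cvg_unique _ ul ul'). Qed.

Lemma eq_indic (R : pzRingType) T T' (A : set T) (B : set T') x y :
  A x = B y -> \1_A x = \1_B y :> R.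
Proof.
move=> AB; rewrite !indicE (_ : (x \in A) = (y \in B))//.
by apply/idP/idP; rewrite !inE AB.
Qed.

Section iterated_expectation.
Context (R : realType) d (T : measurableType d) (mu : probability T R).

(** Integral over the first [n] coordinates. The others are frozen at [point], which is harmless
    when [F] depends on the first [n] only. *)
Fixpoint expect (n : nat) (F : seqspace T -> R) : R :=
  if n is n'.+1 then \int[mu]_y expect n' (fun x => F (scons y x))
  else F (fun=> point).

Definition depends (U : Type) n (F : (nat -> T) -> U) :=
  forall x y, (forall i, (i < n)%N -> x i = y i) -> F x = F y.

Lemma depends_leq U n m (F : (nat -> T) -> U) :
  (n <= m)%N -> depends n F -> depends m F.
Proof. by move=> nm Fn x y xy; apply: Fn => i /leq_trans/(_ nm); exact: xy. Qed.

Lemma depends_scons U n (F : (nat -> T) -> U) y :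
  depends n.+1 F -> depends n (fun x => F (scons y x)).
Proof. by move=> Fn x x' xx'; apply: Fn => -[//|i]; exact: xx'. Qed.

Lemma bounded_mfun_scons (F : seqspace T -> R) : bounded_mfun F ->
  bounded_mfun (fun p : T * seqspace T => F (scons p.1 p.2)).
Proof.
by apply: bounded_mfun_comp; exact: (measurable_scons measurable_fst measurable_snd).
Qed.

Lemma bounded_mfun_scons1 (F : seqspace T -> R) y : bounded_mfun F ->
  bounded_mfun (fun x : seqspace T => F (scons y x)).
Proof. by move=> /bounded_mfun_scons/(bounded_mfun_pair1 y). Qed.

Lemma bounded_mfun_expect n d' (S : measurableType d')
    (F : S * seqspace T -> R) : bounded_mfun F ->
  bounded_mfun (fun s => expect n (fun x => F (s, x))).
Proof.
elim: n d' S F => [|n IHn] d' S F bF /=.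
  by move: bF; apply: bounded_mfun_comp; exact: pair2_measurable.
apply: (@bounded_mfun_Rint _ _ _ _ _ mu
  (fun p : S * T => expect n (fun x => F (p.1, scons p.2 x)))).
apply: (IHn _ (S * T)%type (fun p : (S * T) * seqspace T => F (p.1.1, scons p.1.2 p.2))).
move: bF; apply: bounded_mfun_comp; apply/measurable_fun_pair => /=.
  exact: measurableT_comp measurable_fst measurable_fst.
apply: measurable_scons => //.
exact: measurableT_comp measurable_snd measurable_fst.
Qed.

Lemma bounded_mfun_expect_scons n (F : seqspace T -> R) : bounded_mfun F ->
  bounded_mfun (fun y => expect n (fun x => F (scons y x))).
Proof. by move=> /bounded_mfun_scons/bounded_mfun_expect; exact. Qed.

Lemma expectD n (F F' : seqspace T -> R) : bounded_mfun F -> bounded_mfun F' ->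
  expect n (fun x => F x + F' x) = expect n F + expect n F'.
Proof.
elim: n F F' => [//|n IHn] F F' bF bF' /=.
rewrite -RintD; [|exact: bounded_mfun_expect_scons..].
by apply: eq_Rint => y; rewrite -IHn//; exact: bounded_mfun_scons1.
Qed.

Lemma le_expect n (F F' : seqspace T -> R) : bounded_mfun F -> bounded_mfun F' ->
  (forall x, F x <= F' x) -> expect n F <= expect n F'.
Proof.
elim: n F F' => [|n IHn] F F' bF bF' FF' /=; first exact: FF'.
apply: le_Rint; [exact: bounded_mfun_expect_scons..|].
by move=> y; apply: IHn => //; exact: bounded_mfun_scons1.
Qed.

Lemma expect_ge0 n (F : seqspace T -> R) :
  (forall x, 0 <= F x) -> 0 <= expect n F.
Proof.
elim: n F => [|n IHn] F F0 /=; first exact: F0.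
by apply: Rintegral_ge0 => y _; exact: IHn.
Qed.

Lemma Rint_cst1 (c : R) : \int[mu]_x c = c.
Proof.
rewrite Rint_cst; transitivity (c * fine 1%E); last exact: mulr1.
congr (_ * fine _); exact: probability_setT.
Qed.

Lemma expect_cst n (c : R) : expect n (fun=> c) = c.
Proof. by elim: n => //= n ->; exact: Rint_cst1. Qed.

Lemma eq_expect n (F F' : seqspace T -> R) : F =1 F' -> expect n F = expect n F'.
Proof. by move=> /funext ->. Qed.

Lemma expect_stable n m (F : seqspace T -> R) : depends n F -> (n <= m)%N ->
  expect m F = expect n F.
Proof.
elim: m n F => [|m IHm] n F Fn; first by rewrite leqn0 => /eqP ->.
case: n Fn => [|n] Fn nm /=; last first.
  by apply: eq_Rint => y; rewrite (IHm n)//; exact: depends_scons.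
rewrite -[RHS]Rint_cst1; apply: eq_Rint => y.
rewrite -[RHS](expect_cst m); apply: eq_expect => x; exact: Fn.
Qed.

Lemma depends_indic n (A : set (seqspace T)) : depends n A ->
  depends n (\1_A : seqspace T -> R).
Proof. by move=> An x y /An Axy; exact: eq_indic. Qed.

(** The mass bound is asked for every admissible [n]. They all give the same value by
    [expect_stable], and no choice of [n] has to be carried through the induction. *)
Definition decreasing_cylinders (e : R) (C : nat -> set (seqspace T)) :=
  [/\ forall k, measurable (C k),
      forall k, exists n, depends n (C k),
      forall k, C k.+1 `<=` C k &
      forall k n, depends n (C k) -> e <= expect n \1_(C k)].

(* The inductive step of Kolmogorov's argument: the first coordinate is chosen so
   that the sections keep mass at least e, then the next ones in turn. *)
Lemma decreasing_cylinders_section e C : decreasing_cylinders e C ->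
  exists y, decreasing_cylinders e (fun k => [set x | C k (scons y x)]).
Proof.
move=> [mC Cdep Cd Ce].
have [N CN] := choice Cdep.
have CN1 k : depends (N k).+1 (C k) by exact: depends_leq (CN k).
have bC k : bounded_mfun (\1_(C k) : seqspace T -> R) by exact: bounded_mfun_indic.
pose v k y := expect (N k) (fun x => \1_(C k) (scons y x)).
have v0 k y : 0 <= v k y by exact: expect_ge0.
have v1 k y : v k y <= 1.
  rewrite -[leRHS](expect_cst (N k)); apply: le_expect.
  - exact: bounded_mfun_scons1.
  - exact: bounded_mfun_cst.
  - by move=> x; rewrite indicE lern1 leq_b1.
have bv k : bounded_mfun (v k) by exact: bounded_mfun_expect_scons.
have vE k m y : (N k <= m)%N -> v k y = expect m (fun x => \1_(C k) (scons y x)).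
  move=> Nm; rewrite (@expect_stable (N k) m)//.
  by apply: depends_scons; exact: depends_indic.
have vd y : nonincreasing_seq (v ^~ y).
  apply/nonincreasing_seqP => k.
  rewrite (vE k (maxn (N k) (N k.+1))) ?leq_maxl//.
  rewrite (vE k.+1 (maxn (N k) (N k.+1))) ?leq_maxr//.
  apply: le_expect; [exact: bounded_mfun_scons1..|move=> x].
  rewrite !indicE ler_nat; case: (boolP (_ \in C k.+1)) => //.
  by rewrite inE => /Cd Ckx; rewrite mem_set.
pose w y := limn (v ^~ y).
have vw y : v ^~ y @ \oo --> w y.
  apply: nonincreasing_is_cvgn; first exact: vd.
  by exists 0 => _ [k _ <-]; exact: v0.
have w0 y : 0 <= w y by apply: (cvgn_ge (vw y)) => k; exact: v0.
have w1 y : w y <= 1 by apply: (cvgn_le (vw y)) => k; exact: v1.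
have bw : bounded_mfun w.
  split; last by exists 1 => y; rewrite ger0_norm.
  by apply: (measurable_fun_cvg (fun k => (bv k).1)) => y _; exact: vw.
have Iw : e <= \int[mu]_y w y.
  apply: (@cvgn_ge _ (fun k => \int[mu]_y v k y)); last first.
    by move=> k; exact: (Ce _ _ (CN1 k)).
  apply: (@bounded_cvg_Rint _ _ _ _ _ _ 1) => //.
  - by move=> k; exact: (bv k).1.
  - by move=> k y; rewrite ger0_norm.
  - by apply: aeW => y; exact: vw.
(* If [w < e] everywhere, the positive function [e - w] has integral at most 0, so it vanishes
   almost everywhere, which is impossible for a probability measure. *)
have [y ey] : exists y, e <= w y.
  apply: contrapT => /forallNP we.
  have ltwe y : w y < e by rewrite ltNge; exact/negP/we.
  have : \forall y \ae mu, e - w y = 0.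
    apply: Rint_eq0_ae.
    - by apply: bounded_mfunB => //; exact: bounded_mfun_cst.
    - by move=> y; rewrite subr_ge0 ltW.
    - apply/eqP; rewrite eq_le; apply/andP; split.
        by rewrite RintB ?Rint_cst1 ?subr_le0//; exact: bounded_mfun_cst.
      by apply: Rintegral_ge0 => y _; rewrite subr_ge0 ltW.
  move=> [B [mB B0]]; rewrite (_ : ~` _ = setT).
    rewrite subTset => BT; move: B0; rewrite BT probability_setT => /eqP.
    by rewrite onee_eq0.
  by apply/seteqP; split=> // y _ /= /eqP; rewrite subr_eq0 gt_eqF.
exists y; split.
- move=> k; rewrite -[X in measurable X]setTI.
  exact: (measurable_scons1 y measurableT (mC k)).
- by move=> k; exists (N k); exact: depends_scons.
- by move=> k x /=; exact: Cd.
- move=> k n nk; rewrite (le_trans ey)// (le_trans (nonincreasing_cvgn_ge (vd y) _ k))//.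
  rewrite (vE k (maxn (N k) n)) ?leq_maxl//.
  rewrite (@expect_stable n (maxn (N k) n)) ?leq_maxr//.
  by move=> x x' /nk xx'; exact: eq_indic.
Qed.

(** Repeated sections choose a point [y] coordinate by coordinate. Once [n] coordinates are fixed, a
    set that depends on these [n] has become empty or full, and the mass [e > 0] rules out the empty
    one. *)
Lemma decreasing_cylinders_nonempty e C : 0 < e -> decreasing_cylinders e C ->
  exists x, forall k, C k x.
Proof.
move=> e0 Ce.
pose S := {C | decreasing_cylinders e C}.
have step (s : S) := cid (decreasing_cylinders_section (svalP s)).
pose st := fix st n : S :=
  if n is n'.+1 then exist (decreasing_cylinders e) _ (svalP (step (st n')))
  else exist _ _ Ce.
pose y n := sval (step (st n)).
(* [pre n x] is [x] preceded by the [n] coordinates already chosen. *)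
pose pre n (x : nat -> T) i := if (i < n)%N then y i else x (i - n)%N.
have stE n k x : sval (st n) k x = C k (pre n x).
  elim: n x => [|n IHn] x /=.
    by congr (C k _); apply/funext => i; rewrite /pre subn0.
  rewrite IHn; congr (C k _); apply/funext => i; rewrite /pre.
  case: (ltngtP i n) => [lin|lin|->]; first by rewrite ltnS ltnW.
    by rewrite ltnS leqNgt lin /= -(subnSK lin).
  by rewrite ltnSn subnn.
exists y => k; have [n nk] : exists n, depends n (C k) by have [_] := Ce; exact.
have [_ _ _ /(_ k 0%N)] := svalP (st n).
have s0 : depends 0 (sval (st n) k).
  by move=> x x' _; rewrite !stE; apply: nk => i ik; rewrite /pre ik.
move=> /(_ s0) /=; rewrite indicE; case: (boolP (_ \in _)) => [|_]; last by rewrite leNgt e0.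
rewrite inE stE => + _; rewrite (nk _ y)// => i ik; by rewrite /pre ik.
Qed.

End iterated_expectation.

(* Alias of seqspace whose measurable sets are the sets that depend on finitely
   many coordinates; the Bernoulli measure is extended from them. *)
Definition cylinder_algebra d (T : measurableType d) : Type := seqspace T.
Definition cylinder_display : measure_display -> measure_display. Proof. exact. Qed.

Section cylinder_algebra.
Context d (T : measurableType d).

Definition cylinder (A : set (seqspace T)) := measurable A /\ exists n, depends n A.

Lemma cylinder0 : cylinder set0. Proof. by split => //; exists 0%N. Qed.

Lemma cylinderC A : cylinder A -> cylinder (~` A).
Proof.
move=> [mA [n An]]; split; first exact: measurableC.
by exists n => x y /An Axy; rewrite /setC /= Axy.
Qed.

Lemma cylinderU A B : cylinder A -> cylinder B -> cylinder (A `|` B).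
Proof.
move=> [mA [n An]] [mB [m Bm]]; split; first exact: measurableU.
exists (maxn n m) => x y xy; rewrite /setU /=.
by rewrite (An x y) ?(Bm x y)// => i im; apply: xy;
  rewrite (leq_trans im)// ?leq_maxl ?leq_maxr.
Qed.

HB.instance Definition _ := Pointed.copy (cylinder_algebra T) (seqspace T).
HB.instance Definition _ := @isAlgebraOfSets.Build (cylinder_display d)
  (cylinder_algebra T) cylinder cylinder0 cylinderU cylinderC.

End cylinder_algebra.

(** * Extension of the cylinder probabilities to the Bernoulli measure *)

Section bernoulli.
Context (R : realType) d (T : measurableType d) (mu : probability T R).

Definition cylinder_prob (A : set (cylinder_algebra T)) : \bar R :=
  (expect mu (xget 0%N [set n | depends n A]) (\1_A : seqspace T -> R))%:E.

Lemma cylinder_probE n (A : set (seqspace T)) : depends n A ->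
  cylinder_prob A = (expect mu n (\1_A : seqspace T -> R))%:E.
Proof.
rewrite /cylinder_prob => An.
set m := xget _ _.
have Am : depends m A by apply: (@xgetPex _ 0%N [set n | depends n A]); exists n.
congr EFin; have [nm|mn] := leqP n m.
  by rewrite (@expect_stable _ _ _ mu n m)//; exact: depends_indic.
by rewrite (@expect_stable _ _ _ mu m n)// ?(ltnW mn)//; exact: depends_indic.
Qed.

Lemma cylinder_prob_ge0 A : (0 <= cylinder_prob A)%E.
Proof. by rewrite lee_fin expect_ge0// => x; rewrite indicE. Qed.

Lemma depends_common (A B : set (seqspace T)) : cylinder A -> cylinder B ->
  exists n, depends n A /\ depends n B.
Proof.
move=> [_ [n An]] [_ [m Bm]]; exists (maxn n m); split.
  exact: depends_leq (leq_maxl _ _) An.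
exact: depends_leq (leq_maxr _ _) Bm.
Qed.

Lemma cylinder_prob_additive2 : additive2 cylinder_prob.
Proof.
move=> A B cA cB AB0; have [mA _] : cylinder A := cA; have [mB _] : cylinder B := cB.
have [n [An Bn]] := depends_common cA cB.
rewrite (cylinder_probE An) (cylinder_probE Bn) (@cylinder_probE n); last first.
  by move=> x y xy; rewrite /setU /= (An x y)// (Bn x y).
rewrite -EFinD -expectD; [|exact: bounded_mfun_indic..].
congr EFin; apply: eq_expect => x; rewrite !indicE in_setU.
case: (boolP (x \in A)) => [xA|]; last by rewrite add0r.
rewrite (_ : x \in B = false) ?addr0//; apply/negP; rewrite inE => xB.
by suff : set0 x by []; rewrite -AB0; split => //; rewrite inE in xA.
Qed.

Lemma cylinder_prob0 : cylinder_prob set0 = 0%E.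
Proof. by rewrite (@cylinder_probE 0)// indic0. Qed.

HB.instance Definition _ := isContent.Build _ _ _ cylinder_prob
  cylinder_prob_ge0 ((additive2P cylinder_prob0).2 cylinder_prob_additive2).

(** Kolmogorov's compactness-free argument. If sets [F i] of total mass below that of [A] covered
    it, then [A] minus the first [k] of them would be a decreasing sequence of cylinders with mass
    at least the difference [e], and their common point would lie in no [F i]. *)
Lemma cylinder_prob_sigma_subadditive :
  measurable_subset_sigma_subadditive cylinder_prob.
Proof.
move=> A F cF cA AF; rewrite leNgt; apply/negP => lt.
pose S := (\sum_(i <oo) cylinder_prob (F i))%E.
have S0 : (0 <= S)%E by exact: nneseries_ge0.
have Sfin : S \is a fin_num by rewrite ge0_fin_numE// (lt_trans lt)// ltry.
pose C k := A `\` \big[setU/set0]_(i < k) F i.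
have cU k : cylinder (\big[setU/set0]_(i < k) F i).
  by have := @bigsetU_measurable _ (cylinder_algebra T) _ (index_enum 'I_k) xpredT
    F (fun i _ => cF i).
have cC k : cylinder (C k) := @measurableD _ (cylinder_algebra T) _ _ cA (cU k).
have Afin : cylinder_prob A \is a fin_num by [].
pose e := fine (cylinder_prob A) - fine S.
have e0 : 0 < e by rewrite subr_gt0 -lte_fin !fineK.
have [] := @decreasing_cylinders_nonempty _ _ _ mu e C e0.
  split.
  - by move=> k; case: (cC k).
  - by move=> k; case: (cC k).
  - by move=> k x [Ax]; rewrite big_ord_recr /= not_orP => -[? _].
  - move=> k n nk; rewrite -lee_fin -(cylinder_probE nk) EFinB !fineK// leeBlDl//.
    (* [A] is covered by the first [k] sets together with [C k], so finite subadditivity leaves mass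
       at least [e] for [C k]. *)
    pose F' i := if (i < k)%N then F i else C k.
    rewrite (@le_trans _ _ (\sum_(i < k.+1) cylinder_prob (F' i))%E)//.
      apply: (@content_subadditive _ _ (cylinder_algebra T) cylinder_prob) => //.
        by move=> i _; rewrite /F'; case: ifP => _; [exact: cF|exact: cC].
      move=> x Ax; rewrite big_ord_recr /= {2}/F' ltnn.
      have [|nx] := pselect ((\big[setU/set0]_(i < k) F i) x); last by right.
      rewrite -bigcup_mkord => -[i /= ik Fix]; left; rewrite -bigcup_mkord.
      by exists i => //; rewrite /F' ik.
    rewrite big_ord_recr /= {2}/F' ltnn leeD2r//.
    rewrite (eq_bigr (fun i : 'I_k => cylinder_prob (F i))); last first.
      by move=> i _; rewrite /F' ltn_ord.
    rewrite -(big_mkord xpredT (fun i => cylinder_prob (F i))).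
    exact: nneseries_lim_ge.
move=> x Cx; have [Ax _] := Cx 0%N; have [i _ Fix] := AF _ Ax.
have [_ []] := Cx i.+1; rewrite -bigcup_mkord; by exists i => /=.
Qed.

HB.instance Definition _ := Content_SigmaSubAdditive_isMeasure.Build _ _ _
  cylinder_prob cylinder_prob_sigma_subadditive.

Lemma cylinders_cylinder (A : set (seqspace T)) : cylinders A -> cylinder A.
Proof.
move=> [n [B mB ->]]; split.
  by rewrite -[X in measurable X]setTI; exact: measurable_coord.
by exists n.+1 => x y xy /=; rewrite xy.
Qed.

Lemma sigma_cylinderE :
  <<s (@measurable _ (cylinder_algebra T)) >> = @measurable _ (seqspace T).
Proof.
apply/seteqP; split; last first.
  by apply: sub_smallest2r => //; exact: cylinders_cylinder.
apply: smallest_sub; first exact: sigma_algebra_measurable.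
by move=> A [].
Qed.

Definition bernoulli_measure (A : set (seqspace T)) : \bar R :=
  measure_extension cylinder_prob A.

Lemma bernoulli_measure0 : bernoulli_measure set0 = 0%E.
Proof. exact: (measure0 (measure_extension cylinder_prob)). Qed.

Lemma bernoulli_measure_ge0 A : (0 <= bernoulli_measure A)%E.
Proof. exact: (measure_ge0 (measure_extension cylinder_prob)). Qed.

Lemma bernoulli_measure_sigma_additive : semi_sigma_additive bernoulli_measure.
Proof.
move=> F mF tF mUF.
apply: (@measure_semi_sigma_additive _ _ _ (measure_extension cylinder_prob)) => //.
  by move=> i; rewrite /measurable /= sigma_cylinderE.
by rewrite /measurable /= sigma_cylinderE.
Qed.

HB.instance Definition _ := isMeasure.Build _ _ _ bernoulli_measure
  bernoulli_measure0 bernoulli_measure_ge0 bernoulli_measure_sigma_additive.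

Lemma bernoulli_measureE n (A : set (seqspace T)) : measurable A -> depends n A ->
  bernoulli_measure A = (expect mu n (\1_A : seqspace T -> R))%:E.
Proof.
move=> mA nA; rewrite -cylinder_probE//.
apply: (@measurable_mu_extE _ _ (cylinder_algebra T) cylinder_prob).
by split => //; exists n.
Qed.

Lemma bernoulli_measureT : bernoulli_measure setT = 1%E.
Proof.
rewrite (@bernoulli_measureE 0)//= indicE in_setT//.
Qed.

HB.instance Definition _ := Measure_isProbability.Build _ _ _ bernoulli_measure
  bernoulli_measureT.

Lemma bernoulli_measure_prod (n : nat) (B : nat -> set T) :
  (forall i, measurable (B i)) ->
  bernoulli_measure [set h | forall i, (i < n)%N -> B i (h i)] =
  (\prod_(i < n) mu (B i))%E.
Proof.
move=> mB; rewrite (@bernoulli_measureE n); last 2 first.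
- rewrite (_ : [set _ | _] = \bigcap_(i in `I_n) [set h | B i (h i)]).
    apply: fin_bigcap_measurable => // i _.
    by rewrite -[X in measurable X]setTI; exact: measurable_coord.
  by apply/seteqP; split.
- move=> x y xy; apply/propext.
  by split=> xB i ik; [rewrite -xy|rewrite xy] => //; exact: xB.
elim: n B mB => [|n IHn] B mB /=.
  by rewrite big_ord0 indicE mem_set.
rewrite big_ord_recl -[RHS]fineK; last first.
  by rewrite fin_numM ?fin_num_measure// prode_fin_num// => i _; rewrite fin_num_measure.
congr EFin; rewrite fineM ?fin_num_measure//; last first.
  by rewrite prode_fin_num// => i _; rewrite fin_num_measure.
rewrite -(IHn (fun i => B i.+1))//= mulrC -Rint_indic// -RintZ; last exact: bounded_mfun_indic.
apply: eq_Rint => y; rewrite [X in _ * X]indicE.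
have [yB|yB] := boolP (y \in B 0%N); rewrite ?(mulr1, mulr0).
  apply: eq_expect => x; apply: eq_indic; apply/propext; split=> /= xB.
    by move=> i ik; exact: (xB i.+1).
  by move=> [_|i ik]; [rewrite inE in yB|exact: xB].
rewrite -(expect_cst mu n 0); apply: eq_expect => x.
rewrite indicE memNset// => /(_ 0%N isT) /= By.
by rewrite notin_setE in yB.
Qed.

End bernoulli.

Lemma Rint_image (R : realType) d1 d2 (X : measurableType d1) (Y : measurableType d2)
    (mu : {finite_measure set X -> \bar R}) (nu : {measure set Y -> \bar R})
    (phi : X -> Y) (f : Y -> R) : measurable_fun setT phi ->
  (forall A, measurable A -> nu A = mu (phi @^-1` A)) -> bounded_mfun f ->
  (\int[nu]_y (f y)%:E = \int[mu]_x (f (phi x))%:E)%E.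
Proof.
move=> mphi nuE bf.
rewrite (@eq_measure_integral _ _ _ _ (pushforward mu phi)); last first.
  by move=> A mA _; rewrite nuE.
rewrite integral_pushforward//.
- by apply/measurable_EFinP; case: bf.
- apply: (@bounded_mfun_integrable _ _ _ mu (f \o phi)).
  by move: bf; apply: bounded_mfun_comp.
Qed.

(** * Splitting off the first coordinate of a Bernoulli measure *)

Section iid.
Context (R : realType) d (T : measurableType d) (mu : probability T R).
Variable Q : probability (seqspace T) R.

Definition iid := forall (n : nat) (B : nat -> set T),
  (forall i, measurable (B i)) ->
  Q [set h | forall i, (i < n)%N -> B i (h i)] = (\prod_(i < n) mu (B i))%E.

Hypothesis Qiid : iid.

Let scons2 (p : T * seqspace T) : seqspace T := scons p.1 p.2.

Let measurable_scons2 : measurable_fun setT scons2.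
Proof. exact: measurable_scons measurable_fst measurable_snd. Qed.

Definition boxes : set (set (seqspace T)) :=
  [set A | exists n, exists2 B : nat -> set T, (forall i, measurable (B i)) &
    A = [set h | forall i, (i < n)%N -> B i (h i)]].

Lemma measurable_box n (B : nat -> set T) : (forall i, measurable (B i)) ->
  measurable ([set h | forall i, (i < n)%N -> B i (h i)] : set (seqspace T)).
Proof.
move=> mB; rewrite (_ : [set _ | _] = \bigcap_(i in `I_n) [set h | B i (h i)]).
  apply: fin_bigcap_measurable => // i _.
  by rewrite -[X in measurable X]setTI; exact: measurable_coord.
by apply/seteqP; split.
Qed.

Lemma setI_closed_boxes : setI_closed boxes.
Proof.
move=> _ _ [n [B mB ->]] [n' [B' mB' ->]].
exists (maxn n n').
exists (fun i => (if (i < n)%N then B i else setT) `&`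
   (if (i < n')%N then B' i else setT)).
  by move=> i; apply: measurableI; case: ifP.
apply/seteqP; split => [h [hB hB'] i _ /=|h hBB'].
  by split; case: ifP => // ik; [exact: hB|exact: hB'].
split=> i ik.
  have [] := hBB' i; first by rewrite (leq_trans ik)// leq_maxl.
  by rewrite ik.
have [] := hBB' i; first by rewrite (leq_trans ik)// leq_maxr.
by rewrite ik.
Qed.

Lemma measurable_boxesE : @measurable _ (seqspace T) = <<s boxes >>.
Proof.
apply/seteqP; split; apply: smallest_sub.
- exact: smallest_sigma_algebra.
- move=> _ [n [B mB ->]]; apply: sub_sigma_algebra.
  exists n.+1; exists (fun i => if i == n then B else setT).
    by move=> i; case: ifP.
  apply/seteqP; split => [x Bx i _ /=|x /(_ n)]; first by case: eqP => // ->.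
  by rewrite eqxx; exact.
- exact: sigma_algebra_measurable.
- by move=> _ [n [B mB ->]]; exact: measurable_box.
Qed.

Lemma box_scons n (B : nat -> set T) : (forall i, measurable (B i)) ->
  (\prod_(i < n) mu (B i))%E =
  (mu \x Q)%E (scons2 @^-1` [set h | forall i, (i < n)%N -> B i (h i)]).
Proof.
move=> mB; case: n => [|n].
  rewrite big_ord0 (_ : _ @^-1` _ = setT `*` setT); last by apply/seteqP; split.
  rewrite product_measure1E// -[LHS]mule1.
  by congr (_ * _)%E; apply/esym; exact: probability_setT.
rewrite big_ord_recl -(Qiid n (fun i => mB i.+1)).
apply: etrans (esym (product_measure1E mu Q (mB 0%N)
  (measurable_box n (fun i => mB i.+1)))) _.
congr ((mu \x Q)%E _); apply/seteqP; split => [[y x] /= [By Bx] [_|i ik]//|[y x] /= Byx].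
- exact: Bx.
- by split; [exact: (Byx 0%N)|move=> i ik; exact: (Byx i.+1)].
Qed.

(** Prepending an independent coordinate does not change the law, since both measures agree on the
    boxes, a generating class closed under intersection. All Markov computations below are
    inductions on this identity. *)
Lemma iid_scons (A : set (seqspace T)) : measurable A ->
  Q A = (mu \x Q)%E (scons2 @^-1` A).
Proof.
move=> mA.
pose Q' : {measure set _ -> \bar R} := pushforward (mu \x Q)%E scons2.
change (Q A = Q' measurable_scons2 A).
apply: (measure_unique boxes (fun=> setT)) => //.
- exact: measurable_boxesE.
- exact: setI_closed_boxes.
- by move=> i; exists 0%N; exists (fun=> setT) => //; apply/seteqP; split.
- by rewrite bigcup_const.
- move=> _ [n [B mB ->]]; exact: (etrans (Qiid n mB) (box_scons n mB)).
- by move=> k; exact: (fin_num_fun_lty (fin_num_measure Q)).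
Qed.

Lemma Rint_scons (F : seqspace T -> R) : bounded_mfun F ->
  \int[Q]_h F h = \int[mu]_y \int[Q]_h F (scons y h).
Proof.
move=> bF; rewrite (@bounded_Fubini _ _ _ _ _ mu Q (F \o scons2)); last first.
  by move: bF; exact: bounded_mfun_comp.
rewrite [LHS]/Rintegral; congr fine.
pose PQ : probability (T * seqspace T)%type R := (mu \x Q)%E.
exact: (@Rint_image _ _ _ _ _ PQ Q scons2 F measurable_scons2 iid_scons bF).
Qed.

End iid.

Section almost_everywhere.
Context (R : realType) d (T : measurableType d) (mu : {measure set T -> \bar R}).
Implicit Types P : T -> Prop.

Lemma ae_imp P P' : (forall x, P x -> P' x) ->
  (\forall x \ae mu, P x) -> \forall x \ae mu, P' x.
Proof. by move=> PP'; apply: filterS. Qed.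

Lemma ae_imp2 P P' P'' : (forall x, P x -> P' x -> P'' x) ->
  (\forall x \ae mu, P x) -> (\forall x \ae mu, P' x) -> \forall x \ae mu, P'' x.
Proof. by move=> PP'; apply: filterS2. Qed.

End almost_everywhere.

(** * Approximation of measurable sets *)

(** The triangle inequality [|p - a| <= |p - b| + |b - a|], with the distances to the bit [b]
    written as expressions affine in [p] and in [a], so that their integrals can be compared term by
    term. *)
Lemma dist_bool_le (R : realType) (p : R) (a b : bool) : 0 <= p -> p <= 1 ->
  `|p - a%:R| <= (b%:R + p - 2 * (b%:R * p)) + (b%:R + a%:R - 2 * (b%:R * a%:R)).
Proof.
by move=> p0 p1; rewrite ler_norml; case: a; case: b => /=; apply/andP; split; lra.
Qed.

Lemma indicY (R : realType) T (A B : set T) x :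
  \1_(A `+` B) x = \1_A x + \1_B x - 2 * (\1_A x * \1_B x) :> R.
Proof.
rewrite /setY !indicE in_setU !in_setD.
by case: (x \in A); case: (x \in B) => /=; lra.
Qed.

Lemma ae_cvg_eq0 (R : realType) d (T : measurableType d)
    (mu : {finite_measure set T -> \bar R}) (u : (T -> R)^nat) (M : R) :
  (forall n, measurable_fun setT (u n)) -> (forall n x, 0 <= u n x <= M) ->
  (\forall x \ae mu, cvgn (u ^~ x)) -> (\int[mu]_x u n x) @[n --> \oo] --> (0 : R) ->
  \forall x \ae mu, u ^~ x @ \oo --> (0 : R).
Proof.
move=> mu_ uM ucvg Iu.
have u0 n x : 0 <= u n x by case/andP: (uM n x).
have uM' n x : `|u n x| <= M by rewrite ger0_norm//; case/andP: (uM n x).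
have M0 : 0 <= M by exact: le_trans (u0 0%N point) (le_trans (ler_norm _) (uM' _ _)).
(* The truncated upper limit is bounded and measurable on the whole space, and equals the limit
   wherever [u] converges. Dominated convergence then shows that its integral is 0. *)
pose L x := Num.min M `|limn_sup (u ^~ x)|.
have ubu x : has_ubound (range (u ^~ x)).
  by exists M => _ [n _ <-]; case/andP: (uM n x).
have lbu x : has_lbound (range (u ^~ x)) by exists 0 => _ [n _ <-].
have uL : \forall x \ae mu, u ^~ x @ \oo --> L x.
  apply: ae_imp ucvg => x ux.
  have l0 : 0 <= limn (u ^~ x) by apply: (cvgn_ge ux).
  have lM : limn (u ^~ x) <= M.
    by apply: (cvgn_le ux) => n; rewrite (le_trans (ler_norm _)).
  by rewrite /L (cvg_limn_supE ux) ger0_norm// min_r.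
have L0 x : 0 <= L x by rewrite le_min M0 normr_ge0.
have bL : bounded_mfun L.
  split; last by exists M => x; rewrite ger0_norm// ge_min lexx.
  apply: measurable_minr => //; apply: measurableT_comp => //.
  exact: measurable_fun_limn_sup.
have IL : (\int[mu]_x u n x) @[n --> \oo] --> \int[mu]_x L x.
  exact: (@bounded_cvg_Rint _ _ _ _ _ _ M).
have IL0 : \int[mu]_x L x = 0 by exact: cvg_unique IL Iu.
apply: (ae_imp2 _ uL (Rint_eq0_ae bL L0 IL0)) => x uLx Lx.
by rewrite Lx in uLx.
Qed.

Section approximation.
Context (R : realType) d (T : measurableType d) (mu : {finite_measure set T -> \bar R}).
Variable D : set (set T).
Hypotheses (D0 : D set0) (DC : forall A, D A -> D (~` A))
  (DU : forall A B, D A -> D B -> D (A `|` B)).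

Lemma measurableY (A B : set T) : measurable A -> measurable B -> measurable (A `+` B).
Proof. by move=> mA mB; apply: measurableU; exact: measurableD. Qed.

Lemma measure_le2 (A B C : set T) : measurable A -> measurable B ->
  measurable C -> A `<=` B `|` C -> (mu A <= mu B + mu C)%E.
Proof.
move=> mA mB mC ABC; apply: (@le_trans _ _ (mu (B `|` C))).
  by apply: le_measure => //; rewrite inE//; exact: measurableU.
exact: measureU2.
Qed.

Definition approximable (A : set T) := measurable A /\
  forall e : R, 0 < e -> exists B, [/\ measurable B, D B & (mu (A `+` B) < e%:E)%E].

Lemma approximableC A : approximable A -> approximable (~` A).
Proof.
move=> [mA Aapp]; split; first exact: measurableC.
move=> e /Aapp[B [mB DB AB]]; exists (~` B); split=> //.
- exact: measurableC.
- exact: DC.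
- rewrite (_ : _ `+` _ = A `+` B)//; apply/seteqP; rewrite /setY /setC /setD.
  by split=> x /=; have := pselect (A x); have := pselect (B x); tauto.
Qed.

Lemma approximableU A A' : approximable A -> approximable A' -> approximable (A `|` A').
Proof.
move=> [mA Aapp] [mA' A'app]; split; first exact: measurableU.
move=> e e0; have e20 : 0 < e / 2 by rewrite divr_gt0.
have [B [mB DB AB]] := Aapp _ e20; have [B' [mB' DB' AB']] := A'app _ e20.
exists (B `|` B'); split; [exact: measurableU|exact: DU|].
apply: (@le_lt_trans _ _ (mu (A `+` B) + mu (A' `+` B'))%E).
  apply: measure_le2; [|exact: measurableY..|].
  - by apply: measurableY; exact: measurableU.
  - by move=> x; rewrite /setY /setD /=; tauto.
by rewrite [e]splitr EFinD lteD.
Qed.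

Lemma approximable_bigcup (F : (set T)^nat) :
  (forall n, approximable (F n)) -> approximable (\bigcup_n F n).
Proof.
move=> Fapp; have mF n : measurable (F n) by case: (Fapp n).
split; first exact: bigcupT_measurable.
move=> e e0; have e20 : 0 < e / 2 by rewrite divr_gt0.
pose G n := \big[setU/set0]_(i < n) F i.
have mG n : measurable (G n) by exact: bigsetU_measurable.
have GF n : G n `<=` \bigcup_n F n.
  by move=> x; rewrite /G -bigcup_mkord => -[i _ ?]; exists i.
have Gapp n : approximable (G n).
  rewrite /G; elim: n => [|n IHn]; last by rewrite big_ord_recr; exact: approximableU.
  rewrite big_ord0; split=> // a a0; exists set0; split=> //.
  by rewrite setYK measure0 lte_fin.
have mU : measurable (\bigcup_n F n) by exact: bigcupT_measurable.
have : (mu ((\bigcup_n F n) `\` G n)) @[n --> \oo] --> mu set0.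
  rewrite (_ : set0 = \bigcap_n ((\bigcup_n F n) `\` G n)); last first.
    apply/esym/seteqP; split=> // x FG; have [[i _ Fi] _] := FG 0%N I.
    by have [_ []] := FG i.+1 I; rewrite /G -bigcup_mkord; exists i => /=.
  apply: nonincreasing_cvg_mu => //.
  - rewrite (le_lt_trans (le_measure mu _ _ (@subDsetl _ _ _)))// ?inE//.
    + exact: measurableD.
    + by rewrite ltey_eq fin_num_measure.
  - by move=> n; exact: measurableD.
  - by apply: bigcapT_measurable => n; exact: measurableD.
  - move=> n m nm; apply/subsetPset => x [Fx Gx]; split=> // Gnx; apply: Gx.
    move: Gnx; rewrite /G -!bigcup_mkord => -[i /= im ?].
    by exists i => //=; exact: leq_trans nm.
rewrite measure0 => /fine_cvgP[_] /cvgrPdist_lt /(_ _ e20)[n _ /(_ n (leqnn n))].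
rewrite /= sub0r normrN ger0_norm ?fine_ge0// => FG.
have {}FG : (mu ((\bigcup_n F n) `\` G n) < (e / 2)%:E)%E.
  by rewrite -[X in (X < _)%E]fineK ?lte_fin// fin_num_measure//; exact: measurableD.
have [B [mB DB GB]] := (Gapp n).2 _ e20.
exists B; split=> //.
apply: (@le_lt_trans _ _ (mu ((\bigcup_n F n) `\` G n) + mu (G n `+` B))%E).
  apply: measure_le2.
  - exact: measurableY.
  - exact: measurableD.
  - exact: measurableY.
  - move=> x; have := GF n x; rewrite /setY /setD /=.
    by have := pselect (G n x); tauto.
by rewrite [e]splitr EFinD lteD.
Qed.

(** The approximable sets form a sigma-algebra. This is used for the cylinders, to prove Lévy's 0-1
    law, and for a countable algebra, to prove separability. *)
Lemma approximable_sigma (A : set T) :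
  D `<=` measurable -> <<s D >> A -> approximable A.
Proof.
move=> mD; apply: smallest_sub; last first.
  move=> B DB; split; first exact: mD.
  by move=> e e0; exists B; split=> //; [exact: mD|rewrite setYK measure0 lte_fin].
split.
- split=> // e e0; exists set0; split=> //; by rewrite setYK measure0 lte_fin.
- by move=> B; rewrite setTD; exact: approximableC.
- exact: approximable_bigcup.
Qed.

End approximation.

(** * Random walks and harmonic functions *)

Section harmonic.
Context (R : realType) (G : topologicalGroupType).

Definition harmonic (mu : set (borel G) -> \bar R) (f : borel G -> R) :=
  bounded_mfun f /\
  forall g, (f g)%:E = (\int[mu]_h (f ((g : G) * h)%g)%:E)%E.

End harmonic.

Section random_walk.
Context (R : realType) (G : topologicalGroupType).
Variable G_second_countable : @second_countable G.
Variables (mu : probability (borel G) R) (Q : probability (seqspace (borel G)) R).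
Hypothesis Qmu : is_bernoulli mu Q.
Local Notation path := (seqspace (borel G)).
Implicit Types (f : borel G -> R) (F C : path -> R) (g : borel G).

Let Qiid : iid mu Q := Qmu.

Lemma bounded_mfun_mulgl f g : bounded_mfun f ->
  bounded_mfun (fun h : borel G => f ((g : G) * h)%g).
Proof. by apply: bounded_mfun_comp; exact: measurable_mulgl. Qed.

Lemma bounded_mfun_walk F g : bounded_mfun F ->
  bounded_mfun (fun h : path => F (walk g h)).
Proof. by apply: bounded_mfun_comp; exact: measurable_walk1. Qed.

Lemma bounded_mfun_coord f n : bounded_mfun f -> bounded_mfun (fun x : path => f (x n)).
Proof. by apply: bounded_mfun_comp; exact: measurable_coord. Qed.

Lemma bounded_mfun_position f n g : bounded_mfun f ->
  bounded_mfun (fun h : path => f (walk g h n)).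
Proof. by move=> bf; exact: (bounded_mfun_walk g (bounded_mfun_coord n bf)). Qed.

Lemma bounded_mfun_shift F n : bounded_mfun F ->
  bounded_mfun (fun x : path => F (Defs.shift n x)).
Proof. by apply: bounded_mfun_comp; exact: measurable_shift. Qed.

Definition path_expect F g : R := \int[Q]_h F (walk g h).

Lemma bounded_mfun_path_expect F : bounded_mfun F -> bounded_mfun (path_expect F).
Proof.
move=> bF; apply: (@bounded_mfun_Rint _ _ _ _ _ Q
  (fun p : borel G * path => F (walk p.1 p.2))).
by move: bF; apply: bounded_mfun_comp; exact: measurable_walk.
Qed.

Lemma path_expect_scons F g : bounded_mfun F ->
  path_expect F g =
  \int[mu]_y path_expect (fun x => F (scons g x)) ((g : G) * y)%g.
Proof.
move=> bF; rewrite /path_expect (Rint_scons Qiid); last exact: bounded_mfun_walk.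
by apply: eq_Rint => y; apply: eq_Rint => h; rewrite walk_sconsE.
Qed.

Lemma shift0 (x : path) : Defs.shift 0 x = x.
Proof. by apply/funext => n; rewrite /Defs.shift addn0. Qed.

Lemma shift_walk_scons n g y (h : path) :
  Defs.shift n.+1 (walk g (scons y h)) = Defs.shift n (walk ((g : G) * y)%g h).
Proof. by apply/funext => k; rewrite /Defs.shift addnS walk_scons. Qed.

(** The Markov property with the weight [C] standing for the past: given the first [n] increments,
    the shifted path is a walk issued from its position at time [n]. Induction on the first step
    avoids conditional expectations. *)
Lemma markov n C F g : bounded_mfun C -> bounded_mfun F -> depends n C ->
  \int[Q]_h (C h * F (Defs.shift n (walk g h))) =
  \int[Q]_h (C h * path_expect F (walk g h n)).
Proof.
move=> bC bF; have bFs k g' := bounded_mfun_walk g' (bounded_mfun_shift k bF).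
elim: n C g bC => [|n IHn] C g bC Cn.
  rewrite (_ : C = fun=> C point); last by apply/funext => x; exact: Cn.
  rewrite RintZ//.
  transitivity (C point * path_expect F g); last by rewrite /= Rint_cst1.
  by congr (_ * _); apply: eq_Rint => h; rewrite shift0.
rewrite (Rint_scons Qiid); last first.
  exact: bounded_mfunM.
rewrite [RHS](Rint_scons Qiid); last first.
  apply: bounded_mfunM => //.
  exact: (bounded_mfun_walk g (bounded_mfun_coord n.+1 (bounded_mfun_path_expect bF))).
apply: eq_Rint => y.
under eq_Rint do rewrite shift_walk_scons.
under [RHS]eq_Rint do rewrite walk_scons.
by apply: IHn => //; [exact: bounded_mfun_scons1|exact: depends_scons].
Qed.

Lemma path_expect_shift n F g : bounded_mfun F ->
  path_expect (fun x => F (Defs.shift n x)) g =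
  \int[Q]_h path_expect F (walk g h n).
Proof.
move=> bF; have := @markov n (fun=> 1) F g (bounded_mfun_cst _ _) bF (fun _ _ _ => erefl).
by under eq_Rint do rewrite mul1r; under [RHS]eq_Rint do rewrite mul1r.
Qed.

Definition step f g : R := \int[mu]_h f ((g : G) * h)%g.

Lemma bounded_mfun_step f : bounded_mfun f -> bounded_mfun (step f).
Proof.
move=> bf; apply: (@bounded_mfun_Rint _ _ _ _ _ mu
  (fun p : borel G * borel G => f ((p.1 : G) * p.2)%g)).
by move: bf; apply: bounded_mfun_comp; exact: measurable_mulg.
Qed.

Lemma stepD f f' g : bounded_mfun f -> bounded_mfun f' ->
  step (fun x => f x + f' x) g = step f g + step f' g.
Proof. by move=> bf bf'; apply: RintD; exact: bounded_mfun_mulgl. Qed.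

Lemma stepB f f' g : bounded_mfun f -> bounded_mfun f' ->
  step (fun x => f x - f' x) g = step f g - step f' g.
Proof. by move=> bf bf'; apply: RintB; exact: bounded_mfun_mulgl. Qed.

Lemma stepZ (c : R) f g : bounded_mfun f ->
  step (fun x => c * f x) g = c * step f g.
Proof. by move=> bf; apply: RintZ; exact: bounded_mfun_mulgl. Qed.

Lemma stepN f g : bounded_mfun f -> step (fun x => - f x) g = - step f g.
Proof.
by move=> bf; rewrite -mulN1r -stepZ//; apply: eq_Rint => h; rewrite mulN1r.
Qed.

Lemma step_cst (c : R) g : step (fun=> c) g = c.
Proof. exact: Rint_cst1. Qed.

Lemma step_ge0 f g : (forall x, 0 <= f x) -> 0 <= step f g.
Proof. by move=> f0; apply: Rintegral_ge0 => h _; exact: f0. Qed.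

Lemma step_le f f' g : bounded_mfun f -> bounded_mfun f' ->
  (forall x, f x <= f' x) -> step f g <= step f' g.
Proof.
by move=> bf bf' ff'; apply: le_Rint => [||h]; [exact: bounded_mfun_mulgl..|exact: ff'].
Qed.

Lemma harmonicP f : harmonic mu f <-> bounded_mfun f /\ forall g, step f g = f g.
Proof.
split=> -[bf fE]; split=> // g; have bfg := bounded_mfun_mulgl g bf.
  by apply: EFin_inj; rewrite fE Rint_EFin.
by rewrite -fE [RHS](esym (Rint_EFin _ bfg)).
Qed.

Definition walk_expect n f g : R := \int[Q]_h f (walk g h n).

Lemma bounded_mfun_walk_expect n f : bounded_mfun f -> bounded_mfun (walk_expect n f).
Proof.
move=> bf; apply: (@bounded_mfun_path_expect (fun x => f (x n))).
exact: bounded_mfun_coord.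
Qed.

Lemma walk_expect0 f g : walk_expect 0 f g = f g.
Proof. by rewrite /walk_expect /= Rint_cst1. Qed.

Lemma walk_expectS n f g : bounded_mfun f ->
  walk_expect n.+1 f g = step (walk_expect n f) g.
Proof.
move=> bf; rewrite /walk_expect.
rewrite -/(path_expect (fun x => f (x n.+1)) g) path_expect_scons//.
exact: bounded_mfun_coord.
Qed.

Lemma walk_expectSr n f g : bounded_mfun f ->
  walk_expect n.+1 f g = walk_expect n (step f) g.
Proof.
move=> bf; elim: n g => [|n IHn] g.
  rewrite walk_expectS// walk_expect0.
  by apply: eq_Rint => y; rewrite walk_expect0.
rewrite walk_expectS// walk_expectS; last exact: bounded_mfun_step.
by apply: eq_Rint => y; exact: IHn.
Qed.

Lemma walk_expect_harmonic n f g : harmonic mu f -> walk_expect n f g = f g.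
Proof.
move=> /harmonicP[bf fE]; elim: n => [|n IHn]; first exact: walk_expect0.
by rewrite walk_expectSr// -[RHS]IHn; apply: eq_Rint => h; exact: fE.
Qed.

(** The iterates decrease, and averaging commutes with their bounded limit, which is therefore
    harmonic. The convergence clause makes [q] the greatest harmonic minorant: a harmonic function
    below [f] stays below every iterate. *)
Lemma superharmonic_limit f : bounded_mfun f -> (forall g, step f g <= f g) ->
  exists q, [/\ harmonic mu q, forall g, q g <= f g &
    forall g, (walk_expect n f g) @[n --> \oo] --> q g].
Proof.
move=> bf fs; have [mf [M fM]] := bf.
have bfn n := bounded_mfun_walk_expect n bf.
have bfw g n := bounded_mfun_walk g (bounded_mfun_coord n bf).
have fnM n g : `|walk_expect n f g| <= M.
  rewrite (le_trans (le_normr_Rintegral _ _))//; first exact: bounded_mfun_integrable.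
  rewrite -[leRHS](Rint_cst1 Q); apply: le_Rint => //; last exact: bounded_mfun_cst.
  have [m1 _] := bfw g n; split; first exact: measurableT_comp.
  by exists M => h; rewrite normr_id.
have fnd g : nonincreasing_seq (fun n => walk_expect n f g).
  apply/nonincreasing_seqP => n; rewrite walk_expectSr//; apply: le_Rint => //.
  exact: (bounded_mfun_walk g (bounded_mfun_coord n (bounded_mfun_step bf))).
pose q g := limn (fun n => walk_expect n f g).
have fq g : (walk_expect n f g) @[n --> \oo] --> q g.
  apply: nonincreasing_is_cvgn; first exact: fnd.
  exists (- M) => _ [n _ <-]; rewrite lerNl (le_trans _ (fnM n g))//.
  by rewrite -normrN ler_norm.
have bq : bounded_mfun q.
  split; first by apply: (measurable_fun_cvg (fun n => (bfn n).1)) => g _; exact: fq.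
  by exists M => g; apply: (cvgn_le (cvg_norm (fq g))) => n.
exists q; split=> //; last first.
  by move=> g; rewrite -[leRHS]walk_expect0; exact: (nonincreasing_cvgn_ge (fnd g) _ 0%N).
apply/harmonicP; split=> // g.
have fqS : (step (walk_expect n f) g) @[n --> \oo] --> q g.
  have := fq g; rewrite -cvg_shiftS; apply: cvg_trans; apply: near_eq_cvg.
  by near=> n; rewrite /= walk_expectS.
apply: (cvg_unique _ _ fqS) => //.
apply: (@bounded_cvg_Rint _ _ _ _ _ _ M) => //.
- by move=> n; case: (bounded_mfun_mulgl g (bfn n)).
- exact: bounded_mfun_mulgl.
- by apply: aeW => h; exact: fq.
Unshelve. all: by end_near. Qed.

Lemma path_expect_le F F' g : bounded_mfun F -> bounded_mfun F' ->
  (forall x, F x <= F' x) -> path_expect F g <= path_expect F' g.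
Proof.
move=> bF bF' FF'; apply: le_Rint => [||h]; [exact: bounded_mfun_walk..|exact: FF'].
Qed.

Lemma indic_ge0 T (A : set T) x : 0 <= \1_A x :> R.
Proof. by rewrite indicE. Qed.

Lemma indic_le1 T (A : set T) x : \1_A x <= 1 :> R.
Proof. by rewrite indicE lern1 leq_b1. Qed.

Lemma path_expect_ge0 (A : set path) g : 0 <= path_expect \1_A g.
Proof. by apply: Rintegral_ge0 => h _; exact: indic_ge0. Qed.

Lemma path_expect_le1 (A : set path) g : measurable A -> path_expect \1_A g <= 1.
Proof.
move=> mA; rewrite -[leRHS](Rint_cst1 Q); apply: le_Rint.
- exact/bounded_mfun_walk/bounded_mfun_indic.
- exact: bounded_mfun_cst.
- by move=> h; exact: indic_le1.
Qed.

Lemma measurable_gt d (T : measurableType d) (u : T -> R) (c : R) :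
  bounded_mfun u -> measurable [set x | c < u x].
Proof.
move=> [mu_ _]; rewrite -[X in measurable X]setTI.
rewrite (_ : [set x | _] = u @^-1` `]c, +oo[%classic).
  exact: mu_.
by apply/seteqP; split => x /=; rewrite in_itv/= andbT.
Qed.

Lemma measurable_exceed f (c : R) k : bounded_mfun f ->
  measurable ([set x | c < f (x k)] : set path).
Proof.
move=> bf; rewrite -[X in measurable X]setTI.
exact: (measurable_coord k measurableT (measurable_gt c bf)).
Qed.

(* The bound for the first n+1 positions follows by induction on n from the
   decomposition of the walk at its first step, without stopping times. *)
Lemma maximal_inequality f (c : R) g : harmonic mu f -> (forall g, 0 <= f g) ->
  0 < c -> path_expect \1_[set x : path | exists k, c < f (x k)] g <= f g / c.
Proof.
move=> /harmonicP[bf fE] f0 c0.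
pose D n := [set x : path | exists2 k, (k <= n)%N & c < f (x k)].
have DE n : D n = \bigcup_(k in [set k | (k <= n)%N]) [set x : path | c < f (x k)].
  by apply/seteqP; split.
have mD n : measurable (D n).
  by rewrite DE; apply: bigcup_measurable => k _; exact: measurable_exceed.
have bD n : bounded_mfun (\1_(D n) : path -> R) by exact: bounded_mfun_indic.
have Dn n g' : path_expect \1_(D n) g' <= f g' / c.
  elim: n g' => [|n IHn] g'; have [gc|gc] := ltP c (f g').
  (* For a walk issued from above level [c] the right-hand side is at least 1. *)
  1,3: by rewrite (le_trans (path_expect_le1 _ (mD _)))// ler_pdivlMr ?mul1r ?ltW.
    rewrite (_ : path_expect _ _ = 0) ?divr_ge0 ?(ltW c0)//.
    rewrite -(Rint_cst1 Q 0); apply: eq_Rint => h; rewrite indicE memNset//.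
    by move=> [k]; rewrite leqn0 => /eqP -> /=; rewrite ltNge gc.
  rewrite path_expect_scons// -fE /step.
  rewrite mulrC -RintZ; last exact: bounded_mfun_mulgl.
  apply: le_Rint.
  - apply: (@bounded_mfun_mulgl (path_expect (fun x => \1_(D n.+1) (scons g' x)))).
    exact/bounded_mfun_path_expect/bounded_mfun_scons1.
  - by apply: bounded_mfunM; [exact: bounded_mfun_cst|exact: bounded_mfun_mulgl].
  - move=> y; rewrite mulrC; apply: le_trans (IHn _).
    apply: path_expect_le => //; first exact: bounded_mfun_scons1.
    move=> x; rewrite (@eq_indic _ _ _ (D n.+1) (D n) (scons g' x) x)//.
    apply/propext; split => [[[|k] kn /= cf]|[k kn cf]]; last by exists k.+1.
      by rewrite ltNge gc in cf.
    by exists k.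
pose E := [set x : path | exists k, c < f (x k)].
have mE : measurable E.
  rewrite (_ : E = \bigcup_n D n); first exact: bigcupT_measurable.
  apply/seteqP; split => [x [k cf]|x [n _ [k _ cf]]]; last by exists k.
  by exists k => //; exists k.
suff : (path_expect \1_(D n) g) @[n --> \oo] --> path_expect \1_E g.
  by move=> /cvgn_le; exact.
apply: (@bounded_cvg_Rint _ _ _ _ _ _ 1).
- by move=> n; case: (bounded_mfun_walk g (bD n)).
- by move=> n h; rewrite ger0_norm ?indic_ge0 ?indic_le1.
- exact/bounded_mfun_walk/bounded_mfun_indic.
- apply: aeW => h; have [Eh|Eh] := pselect (E (walk g h)); last first.
    rewrite (_ : (fun n => _) = fun=> \1_E (walk g h)); first exact: cvg_cst.
    apply/funext => n; apply: eq_indic; apply/propext; split=> // -[k _ ck].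
    by exists k.
  have [k ck] := Eh; apply: cvg_near_cst; near=> n.
  apply: eq_indic; apply/propext; split=> // _; exists k => //.
  by near: n; exact: nbhs_infty_ge.
Unshelve. all: by end_near. Qed.

Lemma ae_not_path_expect0 (A : set path) g : measurable A ->
  path_expect \1_A g = 0 -> \forall h \ae Q, ~ A (walk g h).
Proof.
move=> mA A0.
have hA0 : \forall h \ae Q, \1_A (walk g h) = 0 :> R.
  apply: Rint_eq0_ae => //; first exact/bounded_mfun_walk/bounded_mfun_indic.
apply: (ae_imp _ hA0) => h /eqP; rewrite indicE pnatr_eq0 eqb0 => /negP hA Ah.
by apply: hA; rewrite inE.
Qed.

(* With w = q - f^2, where q is the least harmonic majorant of f^2, the function
   q - 2 a f + a^2 = (f - a)^2 + w is harmonic and equals w(g) at g if a = f(g):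
   the maximal inequality bounds the oscillation of f along the walk by w, and
   the expectation of w(x_n) tends to 0. *)
Lemma harmonic_cvg f g : harmonic mu f ->
  \forall h \ae Q, cvgn (fun n => f (walk g h n)).
Proof.
move=> hf; have /harmonicP[bf fE] := hf.
have bf2 : bounded_mfun (fun g => f g * f g) by exact: bounded_mfunM.
have bfg g' := bounded_mfun_mulgl g' bf.
have bf2g g' := bounded_mfun_mulgl g' bf2.
(* The majorant of [f^2] is [-p], with [p] the harmonic limit below [-f^2]. Superharmonicity of
   [-f^2] is the nonnegativity of the mean of [(f - f g')^2] after one step from [g']. *)
have [p [hp pf fp]] : exists p, [/\ harmonic mu p, forall g, p g <= - (f g * f g) &
    forall g, (walk_expect n (fun g => - (f g * f g)) g) @[n --> \oo] --> p g].
  apply: superharmonic_limit; first exact: bounded_mfunN.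
  move=> g'; rewrite stepN//.
  have : 0 <= step (fun x => (f x * f x - (2 * f g') * f x) + f g' * f g') g'.
    apply: step_ge0 => x; rewrite (_ : _ + _ = (f x - f g') ^+ 2) ?sqr_ge0//; ring.
  have b1 := bounded_mfunZ (2 * f g') bf; have b2 := bounded_mfunB bf2 b1.
  by rewrite stepD ?stepB ?stepZ ?step_cst ?fE//; [nra|exact: bounded_mfun_cst..].
have /harmonicP[bp pE] := hp.
pose W g' := - p g' - f g' * f g'.
have W0 g' : 0 <= W g' by rewrite /W subr_ge0 lerNr.
have bW : bounded_mfun W by apply: bounded_mfunB => //; exact: bounded_mfunN.
pose H (a : R) g' := - p g' - 2 * a * f g' + a * a.
have HE a g' : H a g' = (f g' - a) ^+ 2 + W g' by rewrite /H /W; ring.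
have H0 a g' : 0 <= H a g' by rewrite HE addr_ge0// sqr_ge0.
have hH a : harmonic mu (H a).
  have baf := bounded_mfunZ (2 * a) bf.
  have bpaf := bounded_mfunB (bounded_mfunN bp) baf.
  apply/harmonicP; split.
    by apply: bounded_mfunD => //; exact: bounded_mfun_cst.
  move=> g'; rewrite /H stepD//; last exact: bounded_mfun_cst.
  rewrite stepB//; last exact: bounded_mfunN.
  by rewrite stepN// stepZ// step_cst fE pE.
pose D (e : R) := [set x : path | exists k, e < `|f (x k) - f (x 0%N)|].
have mD e : measurable (D e).
  rewrite (_ : D e = \bigcup_k [set x : path | e < `|f (x k) - f (x 0%N)|]); last first.
    by apply/seteqP; split => [x [k ?]|x [k _ ?]]; exists k.
  apply: bigcupT_measurable => k; apply: measurable_gt.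
  apply: bounded_mfun_norm.
  exact: bounded_mfunB (bounded_mfun_coord k bf) (bounded_mfun_coord 0 bf).
have bD e : bounded_mfun (\1_(D e) : path -> R) by exact: bounded_mfun_indic.
(* An oscillation above [e] makes [(f - f g')^2], hence the larger [H (f g')], exceed [e^2] at some
   time. *)
have VD e g' : 0 < e -> path_expect \1_(D e) g' <= W g' / e ^+ 2.
  move=> e0; have -> : W g' = H (f g') g' by rewrite HE subrr expr0n add0r.
  apply: le_trans (maximal_inequality _ (hH _) (H0 _) _); last exact: exprn_gt0.
  apply: le_Rint.
  - exact: bounded_mfun_walk.
  - apply/bounded_mfun_walk/bounded_mfun_indic.
    rewrite (_ : [set _ | _] = \bigcup_k [set x : path | e ^+ 2 < H (f g') (x k)]).
      apply: bigcupT_measurable => k; apply: measurable_exceed.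
      by have /harmonicP[] := hH (f g').
    by apply/seteqP; split => [x [k ?]|x [k _ ?]]; exists k.
  - move=> h; rewrite [leLHS]indicE; case: (boolP (_ \in _)) => [|_]; last exact: indic_ge0.
    rewrite inE => -[k ek]; rewrite indicE mem_set//; exists k; rewrite HE.
    apply: (@lt_le_trans _ _ ((f (walk g' h k) - f g') ^+ 2)); last by rewrite lerDl.
    by rewrite -[ltRHS]real_normK ?num_real// ltr_pXn2r// nnegrE ltW.
pose N e := \bigcap_n [set x : path | D e (Defs.shift n x)].
have mDn e n : measurable [set x : path | D e (Defs.shift n x)].
  by rewrite -[X in measurable X]setTI; exact: (measurable_shift n measurableT (mD e)).
have N0 e : 0 < e -> \forall h \ae Q, ~ N e (walk g h).
  move=> e0; apply: ae_not_path_expect0; first exact: bigcapT_measurable.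
  apply/eqP; rewrite eq_le path_expect_ge0 andbT.
  (* [u n] is the expectation of [W] at time [n] divided by [e^2]: the harmonic [p] keeps its
     expectation, and the iterates of [-f^2] tend to [p g], so [u] tends to 0. *)
  pose u n := (- p g + walk_expect n (fun g => - (f g * f g)) g) / e ^+ 2.
  have u0 : u @ \oo --> (0 : R).
    rewrite -[X in _ --> X](mul0r (e ^+ 2)^-1) -(addNr (p g)).
    by apply: cvgMl; apply: cvgD; [exact: cvg_cst|exact: fp].
  apply: (cvgn_ge u0) => n.
  apply: (@le_trans _ _ (path_expect (fun x => \1_(D e) (Defs.shift n x)) g)).
    apply: path_expect_le.
    - exact/bounded_mfun_indic/bigcapT_measurable.
    - exact: bounded_mfun_shift.
    - move=> x; rewrite [leLHS]indicE; case: (boolP (_ \in _)) => [|_]; last exact: indic_ge0.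
      by rewrite inE => /(_ n I) Dx; rewrite indicE mem_set.
  rewrite path_expect_shift//.
  apply: (@le_trans _ _ (walk_expect n (fun g => (e ^+ 2)^-1 * W g) g)).
    apply: le_Rint.
    - exact: (bounded_mfun_walk g (bounded_mfun_coord n (bounded_mfun_path_expect (bD e)))).
    - exact: (bounded_mfun_walk g (bounded_mfun_coord n (bounded_mfunZ (e ^+ 2)^-1 bW))).
    - by move=> h; rewrite mulrC; exact: VD.
  rewrite /walk_expect RintZ; last exact: (bounded_mfun_walk g (bounded_mfun_coord n bW)).
  rewrite /u mulrC ler_pM2r ?invr_gt0 ?exprn_gt0//.
  rewrite RintD; last 2 first.
  - exact: (bounded_mfun_walk g (bounded_mfun_coord n (bounded_mfunN bp))).
  - exact: (bounded_mfun_walk g (bounded_mfun_coord n (bounded_mfunN bf2))).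
  rewrite lerD2r -(walk_expect_harmonic n g hp) -mulN1r /walk_expect -RintZ.
    apply: le_Rint => [||h]; last by rewrite mulN1r.
      exact: (bounded_mfun_walk g (bounded_mfun_coord n (bounded_mfunN bp))).
    exact: (bounded_mfun_walk g (bounded_mfun_coord n (bounded_mfunZ (-1) bp))).
  exact: (bounded_mfun_walk g (bounded_mfun_coord n bp)).
have /ae_foralln : forall j, \forall h \ae Q, ~ N (j.+1%:R^-1) (walk g h).
  by move=> j; apply: N0; rewrite invr_gt0.
apply: ae_imp => h Nh; apply/cauchy_cvgP/cauchy_exP => e e0.
have [j je] : exists j : nat, j.+1%:R^-1 < e.
  have [j _ /(_ j (leqnn j))] := near_infty_natSinv_lt (PosNum e0).
  by exists j.
have [n nD] : exists n, ~ D j.+1%:R^-1 (Defs.shift n (walk g h)).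
  by apply: contrapT => /forallNP H'; apply: (Nh j) => n _; apply: contrapT; exact: H'.
exists (f (walk g h n)); exists n => // m /= nm.
rewrite /ball/= distrC; apply: le_lt_trans je; rewrite leNgt; apply/negP => jm.
apply: nD; exists (m - n)%N; rewrite /Defs.shift add0n subnK//.
Qed.

Lemma saturated_shift (A : set path) n (x : path) : saturated A ->
  A (Defs.shift n x) = A x.
Proof.
move=> sA; apply/propext; split; apply: sA.
  by exists 0%N, n; exact: shift0.
by exists n, 0%N; rewrite shift0.
Qed.

Lemma saturated_scons (A : set path) g (x : path) : saturated A ->
  A (scons g x) = A x.
Proof.
move=> sA; rewrite -(@saturated_shift A 1 (scons g x))//; congr (A _).
by apply/funext => k; rewrite /Defs.shift addn1.
Qed.

Lemma path_expect_indic_itv (A : set path) g : measurable A ->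
  0 <= path_expect \1_A g <= 1.
Proof. by move=> mA; rewrite path_expect_ge0 path_expect_le1. Qed.

Lemma harmonic_saturated (A : set path) : measurable A -> saturated A ->
  harmonic mu (path_expect \1_A).
Proof.
move=> mA sA; have bA : bounded_mfun (\1_A : path -> R) by exact: bounded_mfun_indic.
apply/harmonicP; split; first exact: bounded_mfun_path_expect.
move=> g; apply/esym; apply: (etrans (path_expect_scons g bA)).
apply: eq_Rint => y; apply: eq_Rint => h; by apply: eq_indic; rewrite saturated_scons.
Qed.

(** Convergence comes from harmonicity, so only the limit has to be identified, in mean. For a
    cylinder [B] close to the event and [n] beyond the coordinates of [B], the Markov property makes
    the mean distance of [phi] at time [n] to [1_B] equal to that of the event itself. *)
Lemma levy (A : set path) g : measurable A -> saturated A ->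
  \forall h \ae Q,
    (path_expect \1_A (walk g h n)) @[n --> \oo] --> (\1_A (walk g h) : R).
Proof.
move=> mA sA; have hA := harmonic_saturated mA sA.
have [bphi _] := hA; set phi := path_expect \1_A in hA bphi *.
have phi01 g' : 0 <= phi g' <= 1 by exact: path_expect_indic_itv.
pose A' : set path := [set h | A (walk g h)].
have mA' : measurable A'.
  rewrite -[X in measurable X]setTI.
  exact: (measurable_walk1 G_second_countable g measurableT mA).
have bA' : bounded_mfun (\1_A' : path -> R) by exact: bounded_mfun_indic.
have A'E h : \1_A' h = \1_A (walk g h) :> R by exact: eq_indic.
have bphin n := bounded_mfun_walk g (bounded_mfun_coord n bphi).
pose u n : path -> R := fun h => `|phi (walk g h n) - \1_A' h|.
have bu n : bounded_mfun (u n) by exact/bounded_mfun_norm/bounded_mfunB.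
have u_cvg : \forall h \ae Q, cvgn (u ^~ h).
  apply: ae_imp (harmonic_cvg g hA) => h phi_cvg.
  apply: is_cvg_norm; apply: is_cvgB => //; exact: is_cvg_cst.
have Iu : (\int[Q]_h u n h) @[n --> \oo] --> (0 : R).
  apply/cvgrPdist_lt => e e0; have e20 : 0 < e / 2 by rewrite divr_gt0.
  have [_ /(_ _ e20)[B [mB [_ [m mBdep]] A'B]]] : approximable Q (@cylinder _ (borel G)) A'.
    apply: approximable_sigma.
    - exact: cylinder0.
    - exact: cylinderC.
    - exact: cylinderU.
    - by move=> ? [].
    - by rewrite sigma_cylinderE.
  have bB : bounded_mfun (\1_B : path -> R) by exact: bounded_mfun_indic.
  (* For [F] with values in [0, 1] this is [|F - 1_B|]. It is affine in [F], so its integral does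
     not change when [phi] at time [n] is replaced by [1_A']. *)
  pose K (F : path -> R) : path -> R := fun h => \1_B h + F h - 2 * (\1_B h * F h).
  have bK F : bounded_mfun F -> bounded_mfun (K F).
    by move=> bF; apply: bounded_mfunB; [exact: bounded_mfunD|exact/bounded_mfunZ/bounded_mfunM].
  have IK F : bounded_mfun F -> \int[Q]_h K F h =
     \int[Q]_h \1_B h + \int[Q]_h F h - 2 * \int[Q]_h (\1_B h * F h).
    move=> bF; have bBF := bounded_mfunM bB bF.
    rewrite RintB ?RintD ?RintZ//; [exact: bounded_mfunD|exact: bounded_mfunZ].
  have KA' h : K \1_A' h = \1_(A' `+` B) h.
    by rewrite /K indicY (addrC (\1_B h)) (mulrC (\1_B h)).
  near=> n.
  have mn : (m <= n)%N by near: n; exact: nbhs_infty_ge.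
  have Bn := depends_indic R (depends_leq mn mBdep).
  have bA : bounded_mfun (\1_A : path -> R) by exact: bounded_mfun_indic.
  have IC (C : path -> R) : bounded_mfun C -> depends n C ->
      \int[Q]_h (C h * phi (walk g h n)) = \int[Q]_h (C h * \1_A' h).
    move=> bC Cn; rewrite -markov//; apply: eq_Rint => h; congr (_ * _).
    by apply: eq_indic; rewrite saturated_shift.
  have IKE : \int[Q]_h K (fun h => phi (walk g h n)) h = \int[Q]_h K \1_A' h.
    rewrite !IK//; congr (_ + _ - 2 * _); last exact: IC.
    have := IC (fun=> 1) (bounded_mfun_cst _ _) (fun _ _ _ => erefl).
    by under eq_Rint do rewrite mul1r; under [RHS]eq_Rint do rewrite mul1r.
  have Ysmall : \int[Q]_h K \1_A' h < e / 2.
    rewrite (eq_Rint _ KA') -lte_fin Rint_indicE//; exact: measurableY.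
  rewrite sub0r normrN ger0_norm; last by apply: Rintegral_ge0 => h _; exact: normr_ge0.
  apply: (@le_lt_trans _ _ (\int[Q]_h (K (fun h => phi (walk g h n)) h + K \1_A' h))).
    apply: le_Rint => //; first by apply: bounded_mfunD; exact: bK.
    move=> h; rewrite /u /K.
    case/andP: (phi01 (walk g h n)); move=> p0 p1.
    by rewrite !indicE dist_bool_le.
  by rewrite RintD ?IKE; [lra|exact: bK..].
apply: (ae_imp _ (ae_cvg_eq0 (M := 1) _ _ u_cvg Iu)).
- move=> h uh; rewrite -A'E; apply/subr_cvg0; exact: norm_cvg0.
- by move=> n; case: (bu n).
- move=> n h; rewrite /u normr_ge0 /= ler_norml.
  case/andP: (phi01 (walk g h n)); move: (phi _) => p p0 p1.
  by rewrite indicE; case: (h \in A') => /=; lra.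
Unshelve. all: by end_near. Qed.
End random_walk.

(** * Two walks with the same harmonic functions *)

Section limit_set.
Context (R : realType) (G : topologicalGroupType).
Local Notation path := (seqspace (borel G)).

(* For f = phi_A this is {lim phi_A = 1} up to null sets; unlike the latter it is
   defined and invariant on all paths. *)
Definition limit_set (f : borel G -> R) : set path :=
  [set x | exists N, forall k, (N <= k)%N -> 2^-1 < f (x k)].

Lemma measurable_limit_set f : bounded_mfun f -> measurable (limit_set f).
Proof.
move=> bf; rewrite (_ : limit_set f =
    \bigcup_N \bigcap_(k in [set k | (N <= k)%N]) [set x : path | 2^-1 < f (x k)]).
  apply: bigcupT_measurable => N; apply: bigcap_measurableType => k _.
  by apply: measurable_gt; exact: bounded_mfun_coord.
by apply/seteqP; split => [x [N Nf]|x [N _ Nf]]; exists N.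
Qed.

Lemma saturated_limit_set f : saturated (limit_set f).
Proof.
move=> x y [m [n xy]] [N Nf]; exists (N + n)%N => k Nk.
have nk : (n <= k)%N by rewrite (leq_trans _ Nk)// leq_addl.
have := congr1 (fun z : nat -> G => z (k - n)%N) xy; rewrite /Defs.shift subnK// => <-.
by apply: Nf; rewrite (@leq_trans (k - n)) ?leq_addr// leq_subRL// addnC.
Qed.

Lemma indic_limit_set f (x : path) (b : bool) :
  (f (x n)) @[n --> \oo] --> (b%:R : R) -> \1_(limit_set f) x = b%:R :> R.
Proof.
move=> fb; rewrite indicE; congr (_%:R); case: b fb => fb.
  rewrite mem_set//; have /cvgr_gt /(_ 2^-1) [|N _ Nf] := fb.
    by rewrite invf_lt1// ltr1n.
  by exists N => k; exact: Nf.
rewrite memNset// => -[N Nf]; have /cvgr_lt /(_ 2^-1) [|M _ Mf] := fb.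
  by rewrite invr_gt0.
have := Nf (maxn N M) (leq_maxl _ _); have := Mf (maxn N M) (leq_maxr _ _).
by rewrite /= => /lt_trans /[apply]; rewrite ltxx.
Qed.

Lemma indic_limit_setE f (x : path) (A : set path) :
  (f (x n)) @[n --> \oo] --> (\1_A x : R) -> \1_(limit_set f) x = \1_A x :> R.
Proof. by rewrite indicE; exact: indic_limit_set. Qed.

End limit_set.

Section two_walks.
Context (R : realType) (G : topologicalGroupType).
Variable G_second_countable : @second_countable G.
Variables (mu : probability (borel G) R) (Q : probability (seqspace (borel G)) R).
Variables (mu' : probability (borel G) R) (Q' : probability (seqspace (borel G)) R).
Hypotheses (Qmu : is_bernoulli mu Q) (Qmu' : is_bernoulli mu' Q').
Hypothesis harmonicE : forall f, harmonic mu f <-> harmonic mu' f.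
Local Notation path := (seqspace (borel G)).
Local Notation phi A := (path_expect Q (\1_A : path -> R)).

Lemma cvgn_min (u v : nat -> R) (a b : R) : u @ \oo --> a -> v @ \oo --> b ->
  (Num.min (u n) (v n)) @[n --> \oo] --> Num.min a b.
Proof.
move=> ua vb; rewrite minr_absE; under eq_cvg do rewrite minr_absE.
by apply: cvgMl; apply: cvgB; [exact: cvgD|apply: cvg_norm; exact: cvgB].
Qed.

Lemma indicIE T (A B : set T) x : \1_(A `&` B) x = Num.min (\1_A x) (\1_B x) :> R.
Proof.
rewrite !indicE in_setI; case: (x \in A); case: (x \in B) => /=.
- by rewrite minxx.
- by rewrite min_r.
- by rewrite min_l.
- by rewrite minxx.
Qed.

Lemma saturatedI (A B : set path) : saturated A -> saturated B -> saturated (A `&` B).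
Proof. by move=> sA sB x y xy [/(sA _ _ xy) ? /(sB _ _ xy)]. Qed.

Lemma path_equiv_sym (x y : nat -> G) : path_equiv x y -> path_equiv y x.
Proof. by move=> [m [n xy]]; exists n, m. Qed.

Lemma saturatedC (A : set path) : saturated A -> saturated (~` A).
Proof. by move=> sA x y /path_equiv_sym xy nAx Ay; apply: nAx; exact: sA Ay. Qed.

Lemma phiI_le (A B : set path) g : measurable A -> measurable B ->
  phi (A `&` B) g <= Num.min (phi A g) (phi B g).
Proof.
move=> mA mB; rewrite le_min; apply/andP; split; apply: path_expect_le => //;
  try (by apply: bounded_mfun_indic => //; exact: measurableI);
  by move=> x; rewrite indicIE ge_min lexx ?orbT.
Qed.

Lemma walk_expect_min (A B : set path) g : measurable A -> saturated A ->
  measurable B -> saturated B ->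
  (walk_expect Q' n (fun g => Num.min (phi A g) (phi B g)) g) @[n --> \oo] -->
    phi (A `&` B) g.
Proof.
move=> mA sA mB sB; set s := fun g => Num.min (phi A g) (phi B g).
have hA := harmonic_saturated G_second_countable Qmu mA sA.
have hB := harmonic_saturated G_second_countable Qmu mB sB.
have mAB := measurableI _ _ mA mB.
have hAB := harmonic_saturated G_second_countable Qmu mAB (saturatedI sA sB).
have /(harmonicP G_second_countable)[bA A_step] := (harmonicE _).1 hA.
have /(harmonicP G_second_countable)[bB B_step] := (harmonicE _).1 hB.
have bAB := hAB.1.
have bs : bounded_mfun s by exact: bounded_mfun_min.
have [q [hq qs sq]] : exists q, [/\ harmonic mu' q, forall g, q g <= s g &
    forall g, (walk_expect Q' n s g) @[n --> \oo] --> q g].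
  apply: superharmonic_limit => // g'; rewrite [in leRHS]/s le_min -A_step -B_step.
  by apply/andP; split; apply: step_le => // x; rewrite ge_min lexx ?orbT.
have bwalk := bounded_mfun_position G_second_countable.
suff -> : phi (A `&` B) g = q g by exact: sq.
apply/eqP; rewrite eq_le; apply/andP; split.
  apply: (cvgn_ge (sq g)) => n.
  rewrite -(walk_expect_harmonic G_second_countable Qmu' n g ((harmonicE _).1 hAB)).
  apply: le_Rint; [exact: bwalk|exact: bwalk|].
  by move=> h; exact: phiI_le.
have qmu := (harmonicE _).2 hq.
have s_cvg : (walk_expect Q n s g) @[n --> \oo] --> phi (A `&` B) g.
  apply: (@bounded_cvg_Rint _ _ _ _ _ _ 1).
  - by move=> n; case: (bwalk _ _ n g bs).
  - move=> n h; have /andP[A0 A1] := path_expect_indic_itv G_second_countable Q (walk g h n) mA.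
    have /andP[B0 B1] := path_expect_indic_itv G_second_countable Q (walk g h n) mB.
    by rewrite ger0_norm /s ?le_min ?A0 ?ge_min ?A1.
  - exact/(bounded_mfun_walk G_second_countable)/bounded_mfun_indic.
  - apply: (ae_imp2 _ (levy G_second_countable Qmu g mA sA)
      (levy G_second_countable Qmu g mB sB)).
    by move=> h hcA hcB; rewrite indicIE; exact: cvgn_min.
apply: (cvgn_ge s_cvg) => n.
rewrite -(walk_expect_harmonic G_second_countable Qmu n g qmu).
apply: le_Rint; [exact: bwalk (hq.1)|exact: bwalk|].
by move=> h; exact: qs.
Qed.

Let position_mfun := bounded_mfun_position (R := R) G_second_countable.
Let path_mfun := bounded_mfun_walk (R := R) G_second_countable.

Lemma phi_harmonic' (A : set path) : measurable A -> saturated A ->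
  harmonic mu' (phi A).
Proof.
by move=> mA sA; apply/harmonicE; exact: (harmonic_saturated G_second_countable Qmu).
Qed.

Lemma phi_cvg (A : set path) g : measurable A -> saturated A ->
  \forall h \ae Q', cvgn (fun n => phi A (walk g h n)).
Proof.
move=> mA sA; exact: (harmonic_cvg G_second_countable Qmu' g (phi_harmonic' mA sA)).
Qed.

Lemma measurable_limit_phi (A : set path) : measurable A -> saturated A ->
  measurable (limit_set (phi A)).
Proof. by move=> mA sA; exact: measurable_limit_set (phi_harmonic' mA sA).1. Qed.

Lemma phi_itv (A : set path) g : measurable A -> 0 <= phi A g <= 1.
Proof. exact: path_expect_indic_itv. Qed.

Lemma phiC (A : set path) g : measurable A -> phi (~` A) g = 1 - phi A g.
Proof.
move=> mA; rewrite -[X in X - _](Rint_cst1 Q) -RintB.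
- apply: eq_Rint => h; rewrite !indicE in_setC.
  by case: (_ \in _); rewrite ?subr0 ?subrr.
- exact: bounded_mfun_cst.
- exact/path_mfun/bounded_mfun_indic.
Qed.

Lemma phi_cvg_limit_set (A : set path) g : measurable A -> saturated A ->
  \forall h \ae Q',
    (phi A (walk g h n)) @[n --> \oo] --> (\1_(limit_set (phi A)) (walk g h) : R).
Proof.
move=> mA sA; pose s g := Num.min (phi A g) (phi (~` A) g).
have mC := measurableC mA; have sC := saturatedC sA.
have bs : bounded_mfun s.
  by apply: bounded_mfun_min; exact: (phi_harmonic' _ _).1.
have s01 g' : 0 <= s g' <= 1.
  have /andP[A0 A1] := phi_itv g' mA; have /andP[B0 B1] := phi_itv g' mC.
  by rewrite /s le_min A0 B0 ge_min A1.
have s_cvg : \forall h \ae Q', (s (walk g h n)) @[n --> \oo] --> (0 : R).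
  apply: (@ae_cvg_eq0 _ _ _ _ (fun n (h : path) => s (walk g h n)) 1) => //.
  - by move=> n; case: (position_mfun n g bs).
  - apply: (ae_imp2 _ (phi_cvg g mA sA) (phi_cvg g mC sC)) => h hA hC.
    by apply: cvgP; apply: cvgn_min; [exact: hA|exact: hC].
  (* [A] and its complement are disjoint, so the expected minimum tends to the probability of the
     empty set. *)
  - have := walk_expect_min (g := g) mA sA mC sC; rewrite setICr.
    rewrite (_ : phi set0 g = 0)//.
    by rewrite -(Rint_cst1 Q' 0); rewrite /path_expect indic0 Rint_cst1 Rint_cst1.
apply: (ae_imp2 _ (phi_cvg g mA sA) s_cvg) => h hA hs.
set l := limn (fun n => phi A (walk g h n)) in hA.
have hl : (phi A (walk g h n)) @[n --> \oo] --> l by exact: hA.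
have : (s (walk g h n)) @[n --> \oo] --> Num.min l (1 - l).
  apply: cvgn_min => //; under eq_cvg do rewrite phiC//.
  by apply: cvgB => //; exact: cvg_cst.
move=> /(cvg_unique (@Rhausdorff R) hs) => l01.
suff [b lb] : exists b : bool, l = b%:R.
  by rewrite lb in hl *; rewrite (indic_limit_set hl).
have [ll|ll] := leP l (1 - l).
  by exists false; move: l01; rewrite min_l// => <-.
exists true; move: l01; rewrite min_r; last exact: ltW.
by move=> /esym/eqP; rewrite subr_eq0 => /eqP <-.
Qed.

(** By harmonicity the expectation of [phi A] along the walk of [mu'] keeps its starting value,
    while dominated convergence sends it to the probability of the limit set. *)
Lemma path_expect_limit_set (A : set path) g : measurable A -> saturated A ->
  path_expect Q' \1_(limit_set (phi A)) g = phi A g.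
Proof.
move=> mA sA; have hA := phi_harmonic' mA sA.
have mT := measurable_limit_set (hA.1).
apply: (@cvgn_uniq _ (fun n => walk_expect Q' n (phi A) g)).
  apply: (@bounded_cvg_Rint _ _ _ _ _ _ 1).
  - by move=> n; case: (position_mfun n g hA.1).
  - by move=> n h; have /andP[p0 p1] := phi_itv (walk g h n) mA; rewrite ger0_norm.
  - exact/path_mfun/bounded_mfun_indic.
  - exact: phi_cvg_limit_set.
under eq_cvg do rewrite (walk_expect_harmonic G_second_countable Qmu' _ g hA).
exact: cvg_cst.
Qed.

(* Events that are recovered from their mu-probabilities along the mu'-paths; for
   them the two walks give the same probability from every starting point. *)
Definition stable_event (E : set path) := [/\ measurable E, saturated E &
  forall g, \forall h \ae Q',
    (phi E (walk g h n)) @[n --> \oo] --> (\1_E (walk g h) : R)].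

Lemma stable_event_prob E g : stable_event E -> path_expect Q' \1_E g = phi E g.
Proof.
move=> [mE sE Ecvg]; rewrite -(path_expect_limit_set g mE sE).
apply: ae_eq_Rint.
- exact/path_mfun/bounded_mfun_indic.
- by apply: path_mfun; apply: bounded_mfun_indic; exact: measurable_limit_phi.
- by apply: (ae_imp _ (Ecvg g)) => h /indic_limit_setE.
Qed.

Lemma phi_limit_set (A : set path) g : measurable A -> saturated A ->
  phi (limit_set (phi A)) g = phi A g.
Proof.
move=> mA sA; apply: ae_eq_Rint.
- by apply: path_mfun; apply: bounded_mfun_indic; exact: measurable_limit_phi.
- exact/path_mfun/bounded_mfun_indic.
- by apply: (ae_imp _ (levy G_second_countable Qmu g mA sA)) => h /indic_limit_setE.
Qed.

Lemma stable_limit_set (A : set path) : measurable A -> saturated A ->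
  stable_event (limit_set (phi A)).
Proof.
move=> mA sA; split.
- exact: measurable_limit_phi.
- exact: saturated_limit_set.
- move=> g; apply: (ae_imp _ (phi_cvg_limit_set g mA sA)) => h hA.
  by under eq_cvg do rewrite phi_limit_set//.
Qed.

Lemma stable_eventC E : stable_event E -> stable_event (~` E).
Proof.
move=> [mE sE Ecvg]; split; [exact: measurableC|exact: saturatedC|move=> g].
apply: (ae_imp _ (Ecvg g)) => h Eh; under eq_cvg do rewrite phiC//.
rewrite (_ : \1_(~` E) _ = 1 - \1_E (walk g h)).
  by apply: cvgB => //; exact: cvg_cst.
by rewrite !indicE in_setC; case: (_ \in _); rewrite ?subr0 ?subrr.
Qed.

(** The minimum of the two probabilities has the right limit. Its excess over [phi] of the
    intersection is nonnegative, converges almost surely, and has expectation tending to 0 by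
    [walk_expect_min], hence tends to 0. *)
Lemma stable_eventI E F : stable_event E -> stable_event F -> stable_event (E `&` F).
Proof.
move=> [mE sE Ecvg] [mF sF Fcvg]; have mEF := measurableI _ _ mE mF.
have sEF := saturatedI sE sF; split=> // g.
have hEF := phi_harmonic' mEF sEF.
pose s g := Num.min (phi E g) (phi F g).
have bs : bounded_mfun s.
  by apply: bounded_mfun_min; exact: (phi_harmonic' _ _).1.
pose u n (h : path) := s (walk g h n) - phi (E `&` F) (walk g h n).
have s_cvg : \forall h \ae Q', (s (walk g h n)) @[n --> \oo] --> (\1_(E `&` F) (walk g h) : R).
  apply: (ae_imp2 _ (Ecvg g) (Fcvg g)) => h hE hF.
  by rewrite indicIE; exact: cvgn_min.
have u_cvg : \forall h \ae Q', u ^~ h @ \oo --> (0 : R).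
  apply: (@ae_cvg_eq0 _ _ _ _ u 1).
  - by move=> n; case: (bounded_mfunB (position_mfun n g bs) (position_mfun n g hEF.1)).
  - move=> n h; rewrite /u subr_ge0 phiI_le//=.
    have /andP[p0 p1] := phi_itv (walk g h n) mE.
    have /andP[q0 q1] := phi_itv (walk g h n) mEF.
    by rewrite lerBlDr (@le_trans _ _ 1) ?lerDl// ge_min p1.
  - apply: (ae_imp2 _ s_cvg (phi_cvg g mEF sEF)) => h hs hEFcvg.
    by apply: is_cvgB => //; apply: cvgP; exact: hs.
  - rewrite -(subrr (phi (E `&` F) g)).
    have -> : (fun n => \int[Q']_h u n h) =
        (fun n => walk_expect Q' n s g - phi (E `&` F) g).
      apply/funext => n; rewrite -(walk_expect_harmonic G_second_countable Qmu' n g hEF).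
      by apply: RintB; [exact: position_mfun|exact: (position_mfun n g hEF.1)].
    by apply: cvgB; [exact: walk_expect_min|exact: cvg_cst].
apply: (ae_imp2 _ s_cvg u_cvg) => h hs hu.
rewrite -[X in _ --> X]subr0.
rewrite (_ : (fun n => _) = (fun n => s (walk g h n) - u n h)); first exact: cvgB.
by apply/funext => n; rewrite /u opprB addrC subrK.
Qed.

Lemma stable_event0 : stable_event set0.
Proof.
split=> // g; apply: aeW => h; rewrite indicE in_set0.
rewrite (_ : (fun n => _) = fun=> 0); first exact: cvg_cst.
apply/funext => n; rewrite -[RHS](Rint_cst1 Q).
by apply: eq_Rint => x; rewrite indicE in_set0.
Qed.

Lemma stable_eventU E F : stable_event E -> stable_event F -> stable_event (E `|` F).
Proof.
move=> sE sF; rewrite -[E `|` F]setCK setCU; apply: stable_eventC.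
by apply: stable_eventI; exact: stable_eventC.
Qed.

Lemma stable_eventY E F : stable_event E -> stable_event F -> stable_event (E `+` F).
Proof.
move=> sE sF; rewrite /setY !setDE.
by apply: stable_eventU; apply: stable_eventI => //; exact: stable_eventC.
Qed.

Lemma saturated_bigcup (F : (set path)^nat) :
  (forall n, saturated (F n)) -> saturated (\bigcup_n F n).
Proof. by move=> sF x y xy [n _ Fx]; exists n => //; exact: sF xy Fx. Qed.

Lemma path_expect_bigcup (P : probability path R) (F : (set path)^nat) g :
  (forall n, measurable (F n)) -> {homo F : n m / (n <= m)%N >-> n `<=` m} ->
  (path_expect P \1_(F n) g) @[n --> \oo] --> path_expect P \1_(\bigcup_n F n) g.
Proof.
move=> mF Fnd; apply: (@bounded_cvg_Rint _ _ _ _ _ _ 1).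
- by move=> n; case: (path_mfun g (bounded_mfun_indic R (mF n))).
- by move=> n h; rewrite ger0_norm ?indic_ge0 ?indic_le1.
- by apply: path_mfun; apply: bounded_mfun_indic; exact: bigcupT_measurable.
- apply: aeW => h; have [[N _ FN]|nF] := pselect ((\bigcup_n F n) (walk g h)).
    apply: cvg_near_cst; near=> n; apply: eq_indic; apply/propext; split=> _.
      by exists N.
    by apply: Fnd FN; near: n; exact: nbhs_infty_ge.
  apply: cvg_near_cst; near=> n; apply: eq_indic; apply/propext; split=> // Fn.
  by exists n.
Unshelve. all: by end_near. Qed.

(** Let [T] be the limit set of [phi] of the union. Monotonicity of [phi] puts each [F n] inside [T]
    up to a null set, and [T] has no more [mu']-probability than the union, because the two walks
    give each [F n] the same probability. So [T] and the union agree almost surely. *)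
Lemma stable_event_bigcup_nd (F : (set path)^nat) :
  (forall n, stable_event (F n)) -> {homo F : n m / (n <= m)%N >-> n `<=` m} ->
  stable_event (\bigcup_n F n).
Proof.
move=> sF Fnd; set E := \bigcup_n F n.
have mF n : measurable (F n) by case: (sF n).
have mE : measurable E by exact: bigcupT_measurable.
have sE : saturated E by apply: saturated_bigcup => n; case: (sF n).
split=> // g; set T := limit_set (phi E).
have mT : measurable T by exact: measurable_limit_phi.
have ET : \forall h \ae Q', E (walk g h) -> T (walk g h).
  have FT : \forall h \ae Q', forall n, F n (walk g h) -> T (walk g h).
    apply: ae_foralln => n; have [_ _ /(_ g)] := sF n => Fcvg.
    apply: (ae_imp2 _ Fcvg (phi_cvg_limit_set g mE sE)) => h hF hT Fn.
    suff : (\1_(F n) (walk g h) : R) <= \1_T (walk g h).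
      rewrite indicE mem_set// indicE; case: (boolP (_ \in T)) => [|_]; first by rewrite inE.
      by rewrite lern0.
    apply: (le_cvgn hF hT) => k; apply: path_expect_le => //.
    - exact: bounded_mfun_indic.
    - exact: bounded_mfun_indic.
    - move=> x; rewrite !indicE ler_nat; case: (boolP (_ \in F n)) => //.
      by rewrite inE => Fx; rewrite mem_set//; exists n.
  by apply: (ae_imp _ FT) => h hFT [n _]; exact: hFT.
have PT : path_expect Q' \1_T g = path_expect Q' \1_E g.
  rewrite path_expect_limit_set//.
  have cE := path_expect_bigcup (P := Q) (g := g) mF Fnd.
  have cE' := path_expect_bigcup (P := Q') (g := g) mF Fnd.
  have FE : (fun n => phi (F n) g) = (fun n => path_expect Q' \1_(F n) g).
    by apply/funext => n; rewrite stable_event_prob.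
  rewrite FE in cE; exact: (@cvgn_uniq _ (fun n => path_expect Q' \1_(F n) g)).
have TE0 : path_expect Q' \1_(T `\` E) g = 0.
  have -> : path_expect Q' \1_(T `\` E) g =
      path_expect Q' \1_T g - path_expect Q' \1_(T `&` E) g.
    rewrite -RintB; last 2 first.
    - by apply: path_mfun; exact: bounded_mfun_indic.
    - by apply: path_mfun; apply: bounded_mfun_indic; exact: measurableI.
    apply: eq_Rint => h; rewrite !indicE in_setD in_setI.
    by case: (_ \in T); case: (_ \in E); rewrite /= ?subrr ?subr0.
  rewrite PT; apply/eqP; rewrite subr_eq0; apply/eqP; apply: ae_eq_Rint.
  - by apply: path_mfun; exact: bounded_mfun_indic.
  - by apply: path_mfun; apply: bounded_mfun_indic; exact: measurableI.
  - apply: (ae_imp _ ET) => h hET; apply: eq_indic; apply/propext.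
    by split=> [Eh|[]//]; split => //; exact: hET.
have TEae := ae_not_path_expect0 G_second_countable (measurableD mT mE) TE0.
apply: (ae_imp2 _ (phi_cvg_limit_set g mE sE))
  (_ : \forall h \ae Q', T (walk g h) = E (walk g h)).
  by move=> h hT TEh; rewrite -(eq_indic R TEh).
apply: (ae_imp2 _ ET TEae) => h hET hTE; apply/propext; split=> [Th|]; last exact: hET.
by apply: contrapT => nE; apply: hTE.
Qed.

Lemma stable_event_bigcup (F : (set path)^nat) :
  (forall n, stable_event (F n)) -> stable_event (\bigcup_n F n).
Proof.
move=> sF; rewrite -(bigcup_bigsetU_bigcup F); apply: stable_event_bigcup_nd.
  move=> n; elim: n.+1 => [|k IHk]; first by rewrite big_ord0; exact: stable_event0.
  by rewrite big_ord_recr; exact: stable_eventU.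
move=> n m nm x; rewrite -!bigcup_mkord => -[i /= im Fi].
by exists i => //=; exact: leq_trans nm.
Qed.

(** This reduces the equality of harmonic measures on all Borel sets to the stability of the
    countably many events that define the boundary map. *)
Lemma sigma_algebra_stable : sigma_algebra setT stable_event.
Proof.
split; first exact: stable_event0.
- by move=> E; rewrite setTD; exact: stable_eventC.
- exact: stable_event_bigcup.
Qed.

End two_walks.

(** * Countable generation and ternary coding *)

Section separability.
Context (R : realType) d (T : measurableType d) (a : (set T)^nat).

(* Trees encode the Boolean expressions in the sets a n, hence the countable
   algebra that they generate. *)
Fixpoint tree_set (t : GenTree.tree nat) : set T :=
  match t with
  | GenTree.Leaf n => a n
  | GenTree.Node 0 [:: t1] => ~` tree_set t1
  | GenTree.Node _ [:: t1; t2] => tree_set t1 `|` tree_set t2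
  | _ => set0
  end.

Lemma measurable_tree_set t : (forall n, measurable (a n)) -> measurable (tree_set t).
Proof.
move=> ma; move: t; fix IH 1 => -[n|n ts] /=; first exact: ma.
case: n => [|n]; case: ts => [|t1 [|t2 [|]]] //=.
- by apply: measurableC; exact: IH.
- by apply: measurableU; exact: IH.
- by apply: measurableU; exact: IH.
Qed.

Lemma countably_generated_separable : @measurable _ T = <<s range a >> ->
  exists e : (set T)^nat, (forall n, measurable (e n)) /\
    forall (P : {finite_measure set T -> \bar R}) (A : set T) (eps : R),
      measurable A -> 0 < eps -> exists n, (P (A `+` e n) < eps%:E)%E.
Proof.
move=> sa; have ma n : measurable (a n).
  by rewrite sa; apply: sub_sigma_algebra; exists n.
exists (fun n => if @unpickle (GenTree.tree nat) n is Some t then tree_set t else set0).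
split=> [n|P A eps mA eps0].
  by case: unpickle => // t; exact: measurable_tree_set.
have [_ /(_ _ eps0)[_ [_ [t _ <-] At]]] : approximable P (range tree_set) A.
  apply: approximable_sigma.
  - by exists (GenTree.Node 0 [::]).
  - by move=> _ [t _ <-]; exists (GenTree.Node 0 [:: t]).
  - by move=> _ _ [t _ <-] [t' _ <-]; exists (GenTree.Node 0 [:: t; t']).
  - by move=> _ [t _ <-]; exact: measurable_tree_set.
  - rewrite sa in mA; apply: sub_smallest2r mA; first exact: smallest_sigma_algebra.
    by move=> _ [n _ <-]; exists (GenTree.Leaf n).
by exists (pickle t); rewrite pickleK.
Qed.

End separability.

Lemma seqspace_countably_generated (G : topologicalGroupType) :
  @second_countable G -> exists a : nat -> set (seqspace (borel G)),
    @measurable _ (seqspace (borel G)) = <<s range a >>.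
Proof.
move=> G2; have [U [oU Ubase]] := countable_base G2.
pose a n : set (seqspace (borel G)) :=
  if @unpickle (nat * nat)%type n is Some (k, i) then [set x | U i (x k)] else set0.
have aE k i : a (pickle (k, i)) = [set x | U i (x k)] by rewrite /a pickleK.
exists a; apply/seteqP; split; last first.
  apply: smallest_sub; first exact: sigma_algebra_measurable.
  move=> _ [n _ <-]; rewrite /a; case: unpickle => // -[k i].
  rewrite -[X in measurable X]setTI; apply: (measurable_coord k measurableT).
  exact: borel_open.
apply: smallest_sub; first exact: smallest_sigma_algebra.
move=> _ [k [B mB ->]].
suff : measurable `<=` [set B : set (borel G) | <<s range a >> [set x | B (x k)]].
  by move=> /(_ B mB).
apply: smallest_sub.
  split => /=.
  - exact: sigma_algebra0.
  - by move=> C sC; exact: (sigma_algebraCD sC).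
  - by move=> F sF; apply: (@sigma_algebra_bigcup _ _ _ (fun n => [set x | F n (x k)])).
move=> W oW /=.
rewrite (_ : [set x | _] =
  \bigcup_i (if pselect (U i `<=` W) then a (pickle (k, i)) else set0)).
  apply: sigma_algebra_bigcup => i.
  case: (pselect (U i `<=` W)) => UW /=; last exact: sigma_algebra0.
  by apply: sub_sigma_algebra; exists (pickle (k, i)).
apply/seteqP; split => [x /= Wx|x [i _]]; last first.
  by case: (pselect (U i `<=` W)) => //= UW; rewrite aE => /UW.
have [i [Uix UiW]] := Ubase _ _ oW Wx; exists i => //.
by case: (pselect (U i `<=` W)) => //=; rewrite aE.
Qed.

(** * Coding a sequence of events by one real number *)

Section ternary_code.
Context (R : realType).
Implicit Types b : nat -> bool.

(** The digits are 0 and 2, as in the Cantor set: a code is at most 1/3 or at least 2/3 according to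
    its first digit, so the digits can be read back. Binary expansions would identify distinct
    sequences. *)
Definition ternary_sum b n : R := \sum_(k < n) (b k)%:R * 2 / 3 ^+ k.+1.

Definition ternary_code b : R := limn (ternary_sum b).

Lemma ternary_sumS b n :
  ternary_sum b n.+1 = ((b 0%N)%:R * 2 + ternary_sum (b \o S) n) / 3.
Proof.
rewrite /ternary_sum big_ord_recl expr1 mulrDl mulr_suml; congr (_ + _).
apply: eq_bigr => i _; rewrite [in LHS]exprS /=; field.
by rewrite expf_neq0.
Qed.

Lemma ternary_sum_itv b n : 0 <= ternary_sum b n <= 1.
Proof.
elim: n b => [|n IHn] b; first by rewrite /ternary_sum big_ord0 lexx ler01.
by rewrite ternary_sumS; have := IHn (b \o S); case: (b 0%N) => /=; lra.
Qed.

Lemma cvg_ternary_sum b : ternary_sum b @ \oo --> ternary_code b.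
Proof.
apply: nondecreasing_is_cvgn.
  apply/nondecreasing_seqP => n; rewrite /ternary_sum big_ord_recr lerDl.
  by rewrite divr_ge0 ?mulr_ge0// exprn_ge0.
by exists 1 => _ [n _ <-]; case/andP: (ternary_sum_itv b n).
Qed.

Lemma ternary_code_itv b : 0 <= ternary_code b <= 1.
Proof.
apply/andP; split.
  by apply: (cvgn_ge (@cvg_ternary_sum b)) => n; case/andP: (ternary_sum_itv b n).
by apply: (cvgn_le (@cvg_ternary_sum b)) => n; case/andP: (ternary_sum_itv b n).
Qed.

Lemma ternary_codeS b :
  ternary_code b = ((b 0%N)%:R * 2 + ternary_code (b \o S)) / 3.
Proof.
have bS : (fun n => ternary_sum b n.+1) @ \oo --> ternary_code b.
  by have := @cvg_ternary_sum b; rewrite -cvg_shiftS.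
apply: (cvgn_uniq bS).
rewrite (_ : (fun n => _) = (fun n => ((b 0%N)%:R * 2 + ternary_sum (b \o S) n) / 3)).
  by apply: cvgMl; apply: cvgD; [exact: cvg_cst|exact: cvg_ternary_sum].
by apply/funext => n; rewrite ternary_sumS.
Qed.

(** Removes [n] digits: multiply by 3 and subtract the leading digit, detected by comparison with
    1/2. Each digit is thus a Borel function of the code. *)
Fixpoint ternary_rest n (y : R) : R :=
  if n is n'.+1 then
    let r := ternary_rest n' y in 3 * r - (if 2^-1 < r then 2 else 0)
  else y.

Lemma ternary_digitE b : (2^-1 < ternary_code b) = b 0%N.
Proof.
rewrite ternary_codeS; have := ternary_code_itv (b \o S).
by case: (b 0%N) => /= /andP[c0 c1]; [apply/idP; lra|apply/negbTE; rewrite -leNgt; lra].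
Qed.

Lemma ternary_restE b n : ternary_rest n (ternary_code b) =
  ternary_code (fun k => b (n + k)%N).
Proof.
elim: n => [//|n IHn] /=; rewrite IHn ternary_digitE [in LHS]ternary_codeS addn0.
rewrite (_ : _ \o _ = (fun k => b (n.+1 + k)%N)); last first.
  by apply/funext => k /=; rewrite addSnnS.
by case: (b n) => /=; field.
Qed.

Lemma measurable_ternary_rest n : measurable_fun setT (ternary_rest n).
Proof.
elim: n => [|n IHn] /=; first exact: measurable_id.
apply: measurable_funB; first exact: measurable_funM.
apply: (measurable_fun_ifT (measurable_fun_ltr (measurable_cst _) IHn)) => //.
Qed.

Lemma measurable_ternary_code d (T : measurableType d) (A : (set T)^nat) :
  (forall n, measurable (A n)) ->
  measurable_fun setT (fun x => ternary_code (fun n => x \in A n)).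
Proof.
move=> mA; apply: (@measurable_fun_cvg _ _ _ _ (fun n x => ternary_sum (fun k => x \in A k) n)).
  move=> n; apply: measurable_sum => k.
  rewrite (_ : (fun x => _) = (fun x => \1_(A k) x * 2 / 3 ^+ k.+1)).
    by apply: measurable_funM => //; apply: measurable_funM => //; exact: measurable_indic.
  by apply/funext => x; rewrite indicE.
by move=> x _; exact: cvg_ternary_sum.
Qed.

Lemma ternary_code_preimage T (A : (set T)^nat) n :
  A n = (fun x => ternary_code (fun n => x \in A n)) @^-1` [set y | 2^-1 < ternary_rest n y].
Proof.
apply/seteqP; split => x /=; rewrite ternary_restE ternary_digitE addn0 => An.
  exact/mem_set.
exact/set_mem.
Qed.

Lemma measurable_ternary_digit n : measurable [set y : R | 2^-1 < ternary_rest n y].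
Proof.
rewrite -[X in measurable X]setTI.
rewrite (_ : [set y | _] = ternary_rest n @^-1` `]2^-1, +oo[%classic).
  exact: (measurable_ternary_rest n measurableT).
by apply/seteqP; split => y /=; rewrite in_itv/= andbT.
Qed.

End ternary_code.

(** * Construction of the boundary *)

Section boundary.
Context (R : realType) (G : topologicalGroupType).
Variable G_second_countable : @second_countable G.
Local Notation path := (seqspace (borel G)).
Local Notation prob P A := (path_expect P (\1_A : path -> R) (1%g : G)).

Let path_mfun := bounded_mfun_walk (R := R) G_second_countable.

Lemma measurable_walk_preimage (A : set path) (g : G) : measurable A ->
  measurable ([set h : path | A (walk g h)] : set path).
Proof.
move=> mA; rewrite -[X in measurable X]setTI.
exact: (measurable_walk1 G_second_countable g measurableT mA).
Qed.

Lemma path_lawE (P : probability path R) (g : G) (A : set path) : measurable A ->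
  path_law P g A = (path_expect P \1_A g)%:E.
Proof.
move=> mA; rewrite /path_law /pushforward /path_expect.
apply: (etrans (esym (Rint_indicE P (measurable_walk_preimage g mA)))).
by congr EFin; apply: eq_Rint => h; exact: eq_indic.
Qed.

Lemma path_law0 (P : probability path R) (A : set path) : measurable A ->
  path_law P 1%g A = 0%E <-> prob P A = 0.
Proof. by move=> mA; rewrite path_lawE//; split=> [[]|->]. Qed.

Lemma probY_le (P : probability path R) (A B C : set path) :
  measurable A -> measurable B -> measurable C ->
  prob P (A `+` C) <= prob P (A `+` B) + prob P (B `+` C).
Proof.
move=> mA mB mC.
rewrite -RintD; last 2 first.
- by apply: path_mfun; apply: bounded_mfun_indic; exact: measurableY.
- by apply: path_mfun; apply: bounded_mfun_indic; exact: measurableY.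
apply: le_Rint.
- by apply: path_mfun; apply: bounded_mfun_indic; exact: measurableY.
- apply: bounded_mfunD.
  + by apply: path_mfun; apply: bounded_mfun_indic; exact: measurableY.
  + by apply: path_mfun; apply: bounded_mfun_indic; exact: measurableY.
move=> h; rewrite !indicY !indicE.
by case: (_ \in A); case: (_ \in B); case: (_ \in C) => /=; lra.
Qed.

(* By Borel-Cantelli, the limsup of a fast approximating sequence is E mod 0. *)
Lemma prob_limsup (P : probability path R) (E : set path) (T : (set path)^nat) :
  measurable E -> (forall n, measurable (T n)) ->
  (forall e, 0 < e -> exists n, prob P (E `+` T n) < e) ->
  exists s : nat -> nat, prob P (E `+` lim_sup_set (T \o s)) = 0.
Proof.
move=> mE mT ET.
have /choice[s sE] : forall k : nat, exists n, prob P (E `+` T n) < 2^-1 ^+ k.+1.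
  by move=> k; apply: ET; rewrite exprn_gt0 ?invr_gt0.
exists s.
pose F k : set path := [set h | (E `+` T (s k)) (walk 1%g h)].
have mF k : measurable (F k) by apply: measurable_walk_preimage; exact: measurableY.
have mlim : measurable (lim_sup_set (T \o s)).
  by apply: bigcapT_measurable => n; apply: bigcup_measurable => k _; exact: mT.
have PF k : (P (F k) <= (2^-1 ^+ k.+1)%:E)%E.
  rewrite (_ : P (F k) = path_law P 1%g (E `+` T (s k)))//.
  by rewrite path_lawE ?lee_fin ?(ltW (sE k))//; exact: measurableY.
have F0 : P (lim_sup_set F) = 0%E.
  apply: lim_sup_set_cvg0 => //; apply: (@le_lt_trans _ _ 1%E); last exact: ltry.
  apply: lime_le; first exact: is_cvg_nneseries.
  apply: nearW => n; apply: (@le_trans _ _ (1 - 2^-1 ^+ n)%:E); last first.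
    by rewrite lee_fin lerBlDr lerDl exprn_ge0// invr_ge0.
  rewrite big_mkord; elim: n => [|n IHn]; first by rewrite big_ord0 expr0 subrr.
  rewrite big_ord_recr /=; apply: (le_trans (leeD IHn (PF n))).
  by rewrite -EFinD lee_fin exprS; lra.
apply/eqP; rewrite eq_le path_expect_ge0 andbT -lee_fin -path_lawE; last exact: measurableY.
apply: (@le_trans _ _ (P (lim_sup_set F))); last by rewrite F0.
rewrite /path_law /pushforward; apply: le_measure; rewrite ?inE.
- by apply: measurable_walk_preimage; exact: measurableY.
- by apply: bigcapT_measurable => n; apply: bigcup_measurable.
move=> h; set x := walk 1%g h => -[[Ex nx]|[xlim nEx]] n _.
  have [N xN] : exists N, forall k, (N <= k)%N -> ~ T (s k) x.
    apply: contrapT => /forallNP H; apply: nx => N _.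
    by have /existsNP[k /not_implyP[Nk /contrapT Tk]] := H N; exists k.
  exists (maxn n N); first exact: leq_maxl.
  by left; split=> //; apply: xN; exact: leq_maxr.
by have [k nk Tk] := xlim n I; exists k => //; right.
Qed.

(** A subset of a separable metric space is separable. The dense events [b j] need not come from
    saturated sets, so for each pair [(j, k)] a saturated event within [1 / (k+1)] of [b j] is
    chosen when there is one, and the empty set otherwise. *)
Lemma saturated_separable (P : probability path R) : exists A : (set path)^nat,
  (forall n, measurable (A n) /\ saturated (A n)) /\
  forall (E : set path) e, measurable E -> saturated E -> 0 < e ->
    exists n, prob P (E `+` A n) < e.
Proof.
have [a aE] := seqspace_countably_generated G_second_countable.
have [b [mb bP]] := countably_generated_separable R aE.
pose near_ (A : set path) j k :=
  (P ([set h : path | A (walk 1%g h)] `+` b j) < (k.+1%:R^-1)%:E)%E.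
have /choice[A AP] : forall n, exists A : set path, (measurable A /\ saturated A) /\
    forall j k : nat, @unpickle (nat * nat)%type n = Some (j, k) ->
      (exists A' : set path, [/\ measurable A', saturated A' & near_ A' j k]) -> near_ A j k.
  move=> n; case Hn : (@unpickle (nat * nat)%type n) => [[j k]|]; last first.
    by exists set0; split => //; split => //.
  have [[A' [mA' sA' nA']]|nA] :=
    pselect (exists A' : set path, [/\ measurable A', saturated A' & near_ A' j k]).
    by exists A'; split=> [|j' k' [<- <-]]; first by split.
  by exists set0; split=> [|j' k' [<- <-] /nA//]; split.
exists A; split=> [n|E e mE sE e0]; first by case: (AP n).
have e20 : 0 < e / 2 by rewrite divr_gt0.
have [k _ /(_ k (leqnn k)) /= ke] := near_infty_natSinv_lt (PosNum e20).
have mE' := measurable_walk_preimage (1%g : G) mE.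
have k0 : 0 < k.+1%:R^-1 :> R by rewrite invr_gt0.
have [j Ej] := bP P _ _ mE' k0.
exists (pickle (j, k)).
have [[mA sA] /(_ j k (pickleK _))] := AP (pickle (j, k)).
set B := A _ in mA sA *; rename mA into mB => /(_ (ex_intro _ E (And3 mE sE Ej))) Bj.
have mB' := measurable_walk_preimage (1%g : G) mB.
rewrite -lte_fin -path_lawE; last exact: measurableY.
apply: (@le_lt_trans _ _ (P ([set h : path | E (walk 1%g h)] `+` b j) +
   P ([set h : path | B (walk 1%g h)] `+` b j))%E).
  apply: measure_le2.
  - by apply: measurable_walk_preimage; exact: measurableY.
  - exact: measurableY.
  - exact: measurableY.
  - move=> h; rewrite /setY /setD /=; have := pselect (b j h); tauto.
have ke' : ((k.+1%:R^-1)%:E < (e / 2)%:E)%E by rewrite lte_fin.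
by rewrite [e]splitr EFinD lteD//; [exact: lt_trans Ej ke'|exact: lt_trans Bj ke'].
Qed.

Lemma standard_borelR : standard_borel R (measurableTypeR R).
Proof. by exists id; split=> // A mA; rewrite image_id. Qed.

(** Invariance of [bnd] makes all preimages saturated, so one inclusion is free and the other has to
    be checked on saturated events only. *)
Lemma is_poisson_boundaryP (P : probability path R) (bnd : path -> measurableTypeR R) :
  measurable_fun setT bnd -> (forall x y, path_equiv x y -> bnd x = bnd y) ->
  (forall E : set path, measurable E -> saturated E ->
    exists2 B, measurable B & prob P (E `+` (bnd @^-1` B)) = 0) ->
  is_poisson_boundary P bnd.
Proof.
move=> mbnd bnd_inv bndP.
have mpre (B : set (measurableTypeR R)) : measurable B -> measurable (bnd @^-1` B).
  by move=> mB; rewrite -[X in measurable X]setTI; exact: (mbnd measurableT).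
split=> [||A]; [exact: standard_borelR|exact: mbnd|split].
  move=> [mA [A0 mA0 [sA0 AA0]]]; split=> //.
  have [B mB A0B] := bndP _ mA0 sA0; exists B => //.
  have mBp := mpre _ mB.
  apply/path_law0; first exact: measurableY.
  apply/eqP; rewrite eq_le path_expect_ge0 andbT.
  apply: (le_trans (probY_le P mA mA0 mBp)).
  have AA0' : prob P (A `+` A0) = 0 by apply/path_law0 => //; exact: measurableY.
  by rewrite A0B AA0' addr0.
move=> [mA [B mB AB]]; split=> //; exists (bnd @^-1` B); first exact: mpre.
by split=> // x y xy; rewrite /preimage /= (bnd_inv _ _ xy).
Qed.

Section same_harmonic_functions.
Variables (mu mu' : probability (borel G) R) (Q Q' : probability path R).
Hypotheses (Qmu : is_bernoulli mu Q) (Qmu' : is_bernoulli mu' Q').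
Hypothesis harmonicE : forall f : borel G -> R, harmonic mu f <-> harmonic mu' f.

(** The construction is run with the walks exchanged: Lévy's law for [mu'] identifies [E] with the
    limit set of its own [mu']-probabilities, and [mu] gives this limit set the same probabilities.
    This is how events of the second walk reach the stable ones. *)
Lemma stable_representative (E : set path) : measurable E -> saturated E ->
  exists2 F, stable_event Q Q' F &
    forall g, \forall h \ae Q', \1_F (walk g h) = \1_E (walk g h) :> R.
Proof.
move=> mE sE; pose f := path_expect Q' (\1_E : path -> R).
have harmonicE' f' : harmonic mu' f' <-> harmonic mu f' by split=> ?; exact/harmonicE.
have levyE g := levy G_second_countable Qmu' g mE sE.
have fF g : path_expect Q \1_(limit_set f) g = f g.
  exact: (path_expect_limit_set G_second_countable Qmu' Qmu harmonicE').
have EF g : \forall h \ae Q', \1_(limit_set f) (walk g h) = \1_E (walk g h) :> R.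
  by apply: (ae_imp _ (levyE g)) => h /indic_limit_setE.
have bf : bounded_mfun f.
  by apply: bounded_mfun_path_expect => //; exact: bounded_mfun_indic.
exists (limit_set f) => //; split.
- exact: measurable_limit_set.
- exact: saturated_limit_set.
- move=> g; apply: (ae_imp2 _ (levyE g) (EF g)) => h hE ->.
  by under eq_cvg do rewrite fF.
Qed.

Lemma same_poisson_boundary_harmonic : same_poisson_boundary mu mu'.
Proof.
have [A [mA Asep]] := saturated_separable Q.
have mA1 n := (mA n).1; have sA n := (mA n).2.
pose T n := limit_set (path_expect Q (\1_(A n) : path -> R)).
pose stable := stable_event Q Q'.
have sT n : stable (T n) by exact: (stable_limit_set G_second_countable Qmu Qmu' harmonicE).
have mT n : measurable (T n) by case: (sT n).
pose bnd (x : path) : measurableTypeR R := ternary_code R (fun n => x \in T n).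
have mbnd : measurable_fun setT bnd by exact: measurable_ternary_code.
have sbnd (B : set (measurableTypeR R)) : measurable B -> stable (bnd @^-1` B).
  move=> mB.
  have sigma := sigma_algebra_stable G_second_countable Qmu Qmu' harmonicE.
  (* Measurability of the code is applied with the stable events as sigma-algebra on the path
     space. *)
  have mT' n : measurable (T n : set (g_sigma_algebraType stable)).
    exact: sub_sigma_algebra.
  have := measurable_ternary_code mT' measurableT mB.
  by rewrite setTI /measurable /= (sigma_algebra_id sigma).
have bnd_inv x y : path_equiv x y -> bnd x = bnd y.
  move=> xy; rewrite /bnd; congr ternary_code; apply/funext => n.
  by apply/idP/idP; rewrite !inE; apply: saturated_limit_set => //; exact: path_equiv_sym.
have limsup_bnd (s : nat -> nat) : exists2 B : set (measurableTypeR R), measurable B &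
    lim_sup_set (T \o s) = bnd @^-1` B.
  pose D n : set (measurableTypeR R) := [set y | 2^-1 < ternary_rest n y].
  have mD n : measurable (D n) by exact: measurable_ternary_digit.
  exists (lim_sup_set (D \o s)).
    by apply: bigcapT_measurable => n; apply: bigcup_measurable => k _; exact: mD.
  rewrite /lim_sup_set preimage_bigcap; apply: eq_bigcapr => n _.
  rewrite preimage_bigcup; apply: eq_bigcupr => k _.
  exact: (@ternary_code_preimage R _ T (s k)).
have AT0 n : prob Q (A n `+` T n) = 0.
  rewrite -(Rint_cst1 Q 0); apply: ae_eq_Rint.
  - by apply: path_mfun; apply: bounded_mfun_indic; exact: measurableY.
  - exact: bounded_mfun_cst.
  - apply: (ae_imp _ (levy G_second_countable Qmu (1%g : G) (mA1 n) (sA n))) => h hA.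
    by rewrite indicY (indic_limit_setE hA) indicE; case: (_ \in _) => /=; lra.
have sepT (E : set path) e : measurable E -> saturated E -> 0 < e ->
    exists n, prob Q (E `+` T n) < e.
  move=> mE sE e0; have [n nE] := Asep E e mE sE e0; exists n; apply: le_lt_trans nE.
  by apply: le_trans (probY_le Q mE (mA1 n) (mT n)) _; rewrite AT0 addr0.
exists Q, Q', _, (measurableTypeR R), bnd, bnd; split.
- by [].
- split; apply: is_poisson_boundaryP => // E mE sE.
    have [e e0|s Es] := @prob_limsup Q E T mE mT; first exact: sepT.
    by have [B mB BE] := limsup_bnd s; exists B; rewrite -?BE.
  have [F sF EF] := stable_representative mE sE.
  have [mF satF _] := sF.
  (* The sequence [T] was chosen dense for [Q]. The difference of two stable events is stable, so it
     has the same probability for [Q'], and density carries over. *)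
  have sY n : stable (F `+` T n).
    exact: (stable_eventY G_second_countable Qmu Qmu' harmonicE sF (sT n)).
  have [e e0|s Fs] := @prob_limsup Q' F T mF mT.
    have [n nF] := sepT F e mF satF e0; exists n.
    by rewrite (stable_event_prob G_second_countable Qmu Qmu' harmonicE (1%g : G) (sY n)).
  have [B mB BE] := limsup_bnd s; exists B => //.
  have mBp : measurable (bnd @^-1` B) by case: (sbnd _ mB).
  apply/eqP; rewrite eq_le path_expect_ge0 andbT.
  apply: (le_trans (probY_le Q' mE mF mBp)).
  rewrite -BE Fs addr0 le_eqVlt; apply/orP; left; apply/eqP.
  rewrite -(Rint_cst1 Q' 0); apply: ae_eq_Rint.
  + by apply: path_mfun; apply: bounded_mfun_indic; exact: measurableY.
  + exact: bounded_mfun_cst.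
  + apply: (ae_imp _ (EF 1%g)) => h hEF.
    by rewrite indicY hEF indicE; case: (_ \in _) => /=; lra.
- by move=> x y xy; split; exact: bnd_inv.
- move=> g B mB; have sB := sbnd _ mB; have [mBp _ _] := sB.
  rewrite /harmonic_measure /pushforward -!/(path_law _ _ _).
  rewrite [LHS](path_lawE Q g mBp) [RHS](path_lawE Q' g mBp).
  by rewrite (stable_event_prob G_second_countable Qmu Qmu' harmonicE g sB).
Qed.

End same_harmonic_functions.

End boundary.

(** * Convolution and renewal *)

Section repackaging.
Context (R : realType) d (T : measurableType d) (m : {measure set T -> \bar R}).

Lemma finite_measure_of : (m setT < +oo)%E ->
  exists m' : {finite_measure set T -> \bar R}, forall B, m' B = m B.
Proof.
move=> moo; exists (mfrestr measurableT moo) => B.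
by rewrite /= /mfrestr /mrestr setIT.
Qed.

Lemma probability_of : m setT = 1%E ->
  exists P : probability T R, forall B, P B = m B.
Proof.
move=> m1; exists (mnormalize m (dirac point)) => B.
by rewrite /= /mnormalize /= m1 onee_eq0 /= invr1 mule1.
Qed.

(* Carries the proof of sigma-finiteness, so that it can be a canonical instance. *)
Definition sigma_finite_copy (sm : sigma_finite setT m) : set T -> \bar R := m.

Section sigma_finite_copy.
Variable sm : sigma_finite setT m.

HB.instance Definition _ := Measure.copy (sigma_finite_copy sm) m.

HB.instance Definition _ :=
  Measure_isSigmaFinite.Build _ _ _ (sigma_finite_copy sm) sm.

End sigma_finite_copy.

End repackaging.

Section convolution.
Context (R : realType) (G : topologicalGroupType).
Variable G_second_countable : @second_countable G.
Local Notation BG := (borel G).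
Implicit Types (al be : {finite_measure set BG -> \bar R}).
Local Open Scope ereal_scope.

Let mulg2 (p : BG * BG) : BG := ((p.1 : G) * p.2)%g.

Let measurable_mulg2 : measurable_fun setT mulg2.
Proof. exact: measurable_mulg. Qed.

Lemma convolutionE al be B :
  convolution al be B = (al \x be) (mulg2 @^-1` B).
Proof.
apply: eq_integral => x _; congr (be _).
by apply/seteqP; split => y; rewrite /xsection /= inE.
Qed.

Lemma measurable_translate (B : set BG) (x : G) : measurable B ->
  measurable ([set y : G | B (x * y)%g] : set BG).
Proof.
move=> mB; rewrite -[X in measurable X]setTI.
exact: (measurable_mulgl G_second_countable x measurableT mB).
Qed.

Lemma measurable_mulg_preimage (B : set BG) : measurable B ->
  measurable (mulg2 @^-1` B).
Proof.
by move=> mB; rewrite -[X in measurable X]setTI; exact: (measurable_mulg2 measurableT).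
Qed.

Lemma measurable_fun_translate be (B : set BG) : measurable B ->
  measurable_fun setT (fun x : BG => be [set y : G | B ((x : G) * y)%g]).
Proof.
move=> mB; have := measurable_fun_xsection be (measurable_mulg_preimage mB).
congr (measurable_fun _ _); apply/funext => x /=; congr (be _).
by apply/seteqP; split => y; rewrite /xsection /= inE.
Qed.

Lemma convolution_setT al be : convolution al be setT = al setT * be setT.
Proof.
rewrite convolutionE (_ : _ @^-1` _ = setT `*` setT); last by apply/seteqP; split.
by rewrite product_measure1E.
Qed.

Lemma convolution_measure al be :
  exists m : {finite_measure set BG -> \bar R}, forall B, m B = convolution al be B.
Proof.
pose m : {measure set BG -> \bar R} := pushforward (al \x be) mulg2.
have mE B : m measurable_mulg2 B = convolution al be B by rewrite convolutionE.
have [|m' m'E] := @finite_measure_of _ _ _ (m measurable_mulg2).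
  by rewrite mE convolution_setT lte_mul_pinfty ?ltey_eq ?fin_num_measure.
by exists m' => B; rewrite m'E.
Qed.

Lemma Rint_measureD al be (m : {measure set BG -> \bar R}) (f : BG -> R) :
  (forall B, measurable B -> m B = al B + be B) -> bounded_mfun f ->
  (\int[m]_y f y = \int[al]_y f y + \int[be]_y f y)%R.
Proof.
move=> mE bf; rewrite /Rintegral (@eq_measure_integral _ _ _ _ (measure_add al be)).
  rewrite integral_measure_add//; try exact: bounded_mfun_integrable.
  by rewrite fineD// integrable_fin_num//; exact: bounded_mfun_integrable.
by move=> A mA _; rewrite mE//; exact/esym/measure_addE.
Qed.

Lemma Rint_convolution al be (m : {measure set BG -> \bar R}) (f : BG -> R) :
  (forall B, measurable B -> m B = convolution al be B) -> bounded_mfun f ->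
  (\int[m]_y f y = \int[al]_x \int[be]_y f ((x : G) * y)%g)%R.
Proof.
move=> mE bf; have bf2 : bounded_mfun (f \o mulg2).
  by move: bf; exact: bounded_mfun_comp.
rewrite [RHS](@bounded_Fubini _ _ _ _ _ al be (f \o mulg2))// /Rintegral; congr fine.
have [|ab abE] := @finite_measure_of _ _ _ (al \x be).
  rewrite (_ : _ setT = al setT * be setT) ?lte_mul_pinfty ?ltey_eq ?fin_num_measure//.
  by rewrite -product_measure1E// setXTT.
rewrite (@eq_measure_integral _ _ _ _ ab); last by move=> A _ _; exact/esym/abE.
apply: Rint_image => // A mA.
by rewrite mE// convolutionE abE.
Qed.

End convolution.

Section renewal.
Context (R : realType) (G : topologicalGroupType).
Variable G_second_countable : @second_countable G.
Local Notation BG := (borel G).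
Implicit Types (al be : {finite_measure set BG -> \bar R}).
Local Open Scope ereal_scope.

Lemma convolution_iterates al be : exists t : nat -> {finite_measure set BG -> \bar R},
  t 0%N = al /\ forall k B, t k.+1 B = convolution be (t k) B.
Proof.
have step t := cid (convolution_measure G_second_countable be t).
exists (fun k => iter k (fun t => sval (step t)) al).
by split => // k B; rewrite -(svalP (step _)).
Qed.

Definition left_invariant (m : set BG -> \bar R) := forall (x : G) (B : set BG),
  measurable B -> m [set y : G | B (x * y)%g] = m B.

(** The solution is the series of the [be^{*k} * al]. By left invariance each convolution by [be]
    multiplies a bound [c m] by [b], the mass of [be], so the terms are at most [C b^k m] and the
    sum at most [C / (1 - b) m]. *)
Lemma renewal_measure al be : 0 < al setT -> al setT + be setT = 1 ->
  exists rho : probability BG R,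
    (forall B : set BG, measurable B -> rho B = al B + convolution be rho B) /\
    forall (m : set BG -> \bar R) (C : R), (0 <= C)%R -> (forall B, 0 <= m B) ->
      left_invariant m ->
      (forall B : set BG, measurable B -> al B <= C%:E * m B) ->
      forall B : set BG, measurable B -> rho B <= (C / fine (al setT))%:E * m B.
Proof.
move=> a0 ab1; have [t [t0 tS]] := convolution_iterates al be.
set a := fine (al setT); pose b := fine (be setT).
have alT : al setT = a%:E by rewrite fineK// fin_num_measure.
have beT : be setT = b%:E by rewrite fineK// fin_num_measure.
have {}a0 : (0 < a)%R by rewrite alT in a0.
have b0 : (0 <= b)%R by rewrite -lee_fin -beT.
have {}ab1 : (a + b = 1)%R by move: ab1; rewrite alT beT => -[].
have cst_be c : \int[be]_x c = c * b%:E by rewrite integral_cst//= beT.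
pose rho0 := mseries (fun k => t k : {measure set BG -> \bar R}) 0.
have rho0E (B : set BG) : measurable B -> rho0 B = al B + convolution be rho0 B.
  move=> mB; rewrite /convolution /rho0 /mseries integral_nneseries//; last first.
    by move=> n; exact: measurable_fun_translate.
  rewrite (nneseries_split 0 1)//= big_nat1 t0; congr (_ + _).
  rewrite -(nneseries_addn 1)//=.
  by apply: eq_eseriesr => k _; rewrite addn1 tS.
have rho0_le (m : set BG -> \bar R) (C : R) : (0 <= C)%R -> (forall B, 0 <= m B) ->
      left_invariant m ->
      (forall B : set BG, measurable B -> al B <= C%:E * m B) ->
      forall B : set BG, measurable B -> rho0 B <= (C / a)%:E * m B.
  move=> C0 m0 mx alm.
  have tm k (B : set BG) : measurable B -> t k B <= (C * b ^+ k)%:E * m B.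
    elim: k B => [|k IHk] B mB; first by rewrite t0 expr0 mulr1 alm.
    rewrite tS /convolution.
    apply: (@le_trans _ _ (\int[be]_x ((C * b ^+ k)%:E * m B))).
      apply: ge0_le_integral => //.
      - exact: measurable_fun_translate.
      - by move=> x _; rewrite -[X in _ * X](mx x B mB); apply: IHk; exact: measurable_translate.
    by rewrite cst_be muleAC -EFinM exprSr mulrA.
  move=> B mB; rewrite /rho0 /mseries; apply: lime_le.
    exact: is_cvg_nneseries.
  apply: nearW => n; apply: (@le_trans _ _ (\sum_(0 <= k < n) ((C * b ^+ k)%:E * m B))).
    by apply: lee_sum => k _; exact: tm.
  rewrite -ge0_sume_distrl; last by move=> k _; rewrite lee_fin mulr_ge0// exprn_ge0.
  rewrite lee_wpmul2r// sumEFin lee_fin -mulr_sumr ler_wpM2l//.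
  rewrite -div1r ler_pdivlMr// (_ : a = 1 - b)%R; last by rewrite -ab1 addrK.
  have -> : ((\sum_(0 <= k < n) b ^+ k) * (1 - b) = 1 - b ^+ n)%R.
    elim: n => [|n IHn]; first by rewrite big_nil mul0r expr0 subrr.
    by rewrite big_nat_recr//= mulrDl IHn exprSr; ring.
  by rewrite gerBl exprn_ge0.
(* The constant set function [a] is left invariant and dominates [al], so the bound just proved
   shows that the total mass [r] is at most 1. Being finite, it can be solved for in
   [r = a + b r]. *)
have rho0T : rho0 setT = 1.
  have T1 : rho0 setT <= 1.
    have := @rho0_le (fun=> a%:E) 1%R ler01 (fun=> ltW a0) (fun _ _ _ => erefl) _ setT.
    rewrite -[X in _ <= X]EFinM div1r mulVf ?gt_eqF//; apply=> // B mB.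
    by rewrite mul1e -alT; apply: le_measure; rewrite ?inE.
  have Tfin : rho0 setT \is a fin_num.
    by rewrite ge0_fin_numE ?(le_lt_trans T1) ?ltry//; exact: nneseries_ge0.
  move: (rho0E setT measurableT) Tfin; rewrite alT /convolution.
  rewrite (_ : \int[be]_x _ = \int[be]_x (rho0 setT)); last by apply: eq_integral.
  move: (rho0 setT) => [r| |] //; rewrite cst_be -EFinM -EFinD => -[rE] _.
  have : (a * r = a)%R by have := congr1 ( *%R^~ r) ab1; lra.
  by move/(congr1 ( *%R a^-1)%R); rewrite mulrA !mulVf ?gt_eqF// mul1r => ->.
have [rho rhoE] : exists rho : probability BG R, forall B, rho B = rho0 B := probability_of rho0T.
exists rho; split => [B mB|m C C0 m0 mx alm B mB]; last by rewrite rhoE; exact: rho0_le.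
rewrite rhoE rho0E//; congr (_ + _); by apply: eq_integral => x _; rewrite rhoE.
Qed.

End renewal.

Section harmonic_renewal.
Context (R : realType) (G : topologicalGroupType).
Variable G_second_countable : @second_countable G.
Local Notation BG := (borel G).
Variables (al be : {finite_measure set BG -> \bar R}) (theta rho : probability BG R).
Hypothesis thetaE : forall B, measurable B -> theta B = (al B + be B)%E.
Hypothesis rhoE : forall B, measurable B -> rho B = (al B + convolution be rho B)%E.
Hypothesis al_gt0 : (0 < al setT)%E.
Implicit Types f u : BG -> R.

(** Each use of the equation gains a factor [b], the mass of [be], which is below 1 because [al]
    takes some of the mass of the probability [theta]. *)
Lemma contracted_eq0 u : bounded_mfun u ->
  (forall g, u g = \int[be]_x u ((g : G) * x)%g) -> forall g, u g = 0.
Proof.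
move=> bu uE; set b := fine (be setT).
have [_ [M uM]] := bu.
have b0 : 0 <= b by exact: fine_ge0.
have b1 : b < 1.
  have alT : al setT = (fine (al setT))%:E by rewrite fineK// fin_num_measure.
  have beT : be setT = b%:E by rewrite fineK// fin_num_measure.
  have := thetaE measurableT; rewrite probability_setT alT beT => -[] ab1.
  by move: al_gt0; rewrite alT lte_fin ab1 ltrDr.
have uk k g : `|u g| <= M * b ^+ k.
  elim: k g => [|k IHk] g; first by rewrite expr0 mulr1.
  have bug := bounded_mfun_mulgl G_second_countable g bu.
  rewrite uE (le_trans (le_normr_Rintegral _ _))//; first exact: bounded_mfun_integrable.
  rewrite exprSr mulrA -Rint_cst; apply: le_Rint => //; first exact: bounded_mfun_norm.
  exact: bounded_mfun_cst.
move=> g; apply/eqP; rewrite -normr_le0.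
apply: (@cvgn_ge _ (fun k => M * b ^+ k)) (uk ^~ g).
rewrite -[X in _ --> X](mulr0 M); apply: cvgMr.
by apply: cvg_expr; rewrite ger0_norm.
Qed.

Lemma renewal_act f g : bounded_mfun f -> \int[rho]_h f ((g : G) * h)%g =
  \int[al]_h f ((g : G) * h)%g + \int[be]_x \int[rho]_h f ((g : G) * x * h)%g.
Proof.
move=> bf; have bfg := bounded_mfun_mulgl G_second_countable g bf.
have [m mE] := convolution_measure G_second_countable be rho.
rewrite (@Rint_measureD _ _ al m rho)//; last by move=> B mB; rewrite mE; exact: rhoE.
congr +%R; rewrite (Rint_convolution G_second_countable (fun B _ => mE B) bfg).
by apply: eq_Rint => x; apply: eq_Rint => y; rewrite mulgA.
Qed.

(** If [f] is harmonic for [rho], the inner average in the renewal equation is [f] itself, which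
    leaves the equation for [theta]. Conversely, subtracting the two equations shows that
    [step rho f - f] equals its own [be]-average, so it is 0 by contraction. *)
Lemma harmonic_renewal f : harmonic rho f <-> harmonic theta f.
Proof.
have thetaI g : bounded_mfun f -> \int[theta]_h f ((g : G) * h)%g =
    \int[al]_h f ((g : G) * h)%g + \int[be]_h f ((g : G) * h)%g.
  by move=> bf; apply: Rint_measureD => //; exact: bounded_mfun_mulgl.
split=> /(harmonicP G_second_countable)[bf fE];
  apply/(harmonicP G_second_countable); split => // g.
  rewrite /step thetaI// -[RHS]fE /step renewal_act//; congr +%R.
  by apply: eq_Rint => x; rewrite -[LHS]fE.
apply/eqP; rewrite -subr_eq0; apply/eqP; move: g.
have br := bounded_mfun_step G_second_countable rho bf.
apply: contracted_eq0; first exact: bounded_mfunB.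
move=> g; rewrite /step RintB; last exact: bounded_mfun_mulgl.
  2: exact: (bounded_mfun_mulgl G_second_countable g br).
rewrite renewal_act// -[X in _ - X]fE /step thetaI//; lra.
Qed.

End harmonic_renewal.

(** * A probability measure that dominates all convolution powers *)

Section geometric_mixture.
Context (R : realType) (G : topologicalGroupType).
Variable G_second_countable : @second_countable G.
Local Notation BG := (borel G).
Variable mu : probability BG R.
Local Open Scope ereal_scope.

Lemma convolution_power_measure n :
  exists t : {finite_measure set BG -> \bar R}, convolution_power mu n = t.
Proof.
elim: n => [|n [t tE]] /=; first by exists (\d_(1%g : BG)).
rewrite tE; have [t' t'E] := convolution_measure G_second_countable mu t.
by exists t'; apply/funext => B; rewrite t'E.
Qed.

Lemma convolution_power1 (B : set BG) : measurable B -> convolution_power mu 1 B = mu B.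
Proof.
move=> mB; transitivity (\int[mu]_x (\1_B x)%:E); last by rewrite integral_indic// setIT.
by apply: eq_integral => x _; rewrite diracE; congr (_%:E); apply: eq_indic; rewrite /= mulg1.
Qed.

(** The measure solves the renewal equation with both parts equal to [mu / 2]. [harmonic_renewal]
    compares it with [mu], the sum of the parts, and the two summands of the equation give
    [mu <= 2 theta] and [mu * theta <= 2 theta], from which the powers follow by induction. *)
Lemma geometric_mixture : exists theta : probability BG R,
  (forall f, harmonic theta f <-> harmonic mu f) /\
  forall n (B : set BG), measurable B ->
    convolution_power mu n.+1 B <= (2 ^+ n.+1)%:E * theta B.
Proof.
have h0 : (0 <= 2^-1 :> R)%R by rewrite invr_ge0.
pose half : {finite_measure set BG -> \bar R} := mscale (NngNum h0) mu.
have halfE B : half B = (2^-1)%:E * mu B by [].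
have muE (B : set BG) : measurable B -> mu B = half B + half B.
  move=> mB; rewrite !halfE -(fineK (fin_num_measure mu _ mB)) -!EFinM -EFinD.
  by congr (_%:E); lra.
have half1 : half setT = (2^-1)%:E by rewrite halfE probability_setT mule1.
have half_gt0 : 0 < half setT by rewrite half1 lte_fin invr_gt0.
have halfD : half setT + half setT = 1 by rewrite half1 -EFinD; congr (_%:E); lra.
have [theta [thetaE _]] := renewal_measure G_second_countable half_gt0 halfD.
have two_half (y : \bar R) : y = 2%:E * ((2^-1)%:E * y).
  by rewrite muleA -EFinM divff ?mul1e.
have mu_le (B : set BG) : measurable B -> mu B <= 2%:E * theta B.
  move=> mB; rewrite [X in X <= _]two_half lee_pmul2l// -halfE thetaE// leeDl//.
  exact: integral_ge0.
have mut (B : set BG) : measurable B -> convolution mu theta B <= 2%:E * theta B.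
  move=> mB; rewrite [X in X <= _]two_half lee_pmul2l// thetaE//.
  rewrite -(ge0_integral_mscale mu measurableT (NngNum h0))//; last exact: measurable_fun_translate.
  by rewrite leeDr.
exists theta; split => [f|]; first exact: (harmonic_renewal G_second_countable muE thetaE).
elim=> [|n IHn] B mB; first by rewrite convolution_power1// expr1 mu_le.
have [t tE] := convolution_power_measure n.+1.
change (convolution mu (convolution_power mu n.+1) B <= (2 ^+ n.+2)%:E * theta B).
rewrite tE in IHn *.
apply: (@le_trans _ _ (\int[mu]_x ((2 ^+ n.+1)%:E * theta [set y : G | B ((x : G) * y)%g]))).
  apply: ge0_le_integral => //.
  - exact: measurable_fun_translate.
  - by apply: measurable_funeM; exact: measurable_fun_translate.
  - by move=> x _; apply: IHn; exact: measurable_translate.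
rewrite ge0_integralZl//; last exact: measurable_fun_translate.
rewrite [X in (X)%:E * theta B]exprSr EFinM -muleA lee_pmul2l//; exact: mut.
Qed.

End geometric_mixture.

(** * Bounded densities *)

Section densities.
Context (R : realType) d (T : measurableType d).
Local Open Scope ereal_scope.

Lemma real_density (m : {sigma_finite_measure set T -> \bar R})
    (nu : {finite_measure set T -> \bar R}) : nu `<< m ->
  exists r : T -> R, [/\ measurable_fun setT r, forall x, (0 <= r x)%R &
    forall A, measurable A -> nu A = \int[m]_(x in A) (r x)%:E].
Proof.
move=> /radon_nikodym_sigma_finite[f [f0 ffin fint fE]].
exists (fine \o f); split.
- by apply: measurableT_comp => //; exact: measurable_int fint.
- by move=> x; exact: fine_ge0.
- by move=> A mA; rewrite fE//; apply: eq_integral => x _; rewrite fineK.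
Qed.

Lemma integral_le_cst (m : {measure set T -> \bar R}) (r : T -> R) (c : R) A :
  measurable_fun setT r -> (forall x, (0 <= r x)%R) -> measurable A ->
  (forall x, A x -> (r x <= c)%R) -> \int[m]_(x in A) (r x)%:E <= c%:E * m A.
Proof.
move=> mr r0 mA rc; rewrite -integral_cst//; apply: ge0_le_integral => //.
- by move=> x _; rewrite lee_fin.
- by apply/measurable_EFinP; exact: measurable_funS mr.
Qed.

Lemma integral_ge_cst (m : {measure set T -> \bar R}) (r : T -> R) (c : R) A :
  measurable_fun setT r -> (0 <= c)%R -> measurable A ->
  (forall x, A x -> (c <= r x)%R) -> c%:E * m A <= \int[m]_(x in A) (r x)%:E.
Proof.
move=> mr c0 mA cr; rewrite -integral_cst//; apply: ge0_le_integral => //.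
apply/measurable_EFinP; exact: measurable_funS mr.
Qed.

(** Differentiating against [nu + m], which always dominates [nu], makes the Radon-Nikodym theorem
    applicable without a prior Lebesgue decomposition. *)
Lemma nonsingular_part (m : {measure set T -> \bar R})
    (nu : {finite_measure set T -> \bar R}) : sigma_finite setT m ->
  ~ (exists2 A, measurable A & m A = 0 /\ nu (~` A) = 0) ->
  exists D (C : R), [/\ measurable D, (0 <= C)%R, 0 < nu D &
    forall B, measurable B -> nu (B `&` D) <= C%:E * m B].
Proof.
move=> [F FT mF] nsing.
pose lam : {measure set T -> \bar R} := measure_add nu m.
have lamE A : lam A = nu A + m A by exact: measure_addE.
have slam : sigma_finite setT lam.
  exists F => // i; have [mFi Fi] := mF i; split => //.
  by rewrite lamE lte_add_pinfty// ltey_eq fin_num_measure.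
have [r [mr r0 rE]] : exists r : T -> R, [/\ measurable_fun setT r, forall x, (0 <= r x)%R &
    forall A, measurable A -> nu A = \int[lam]_(x in A) (r x)%:E].
  apply: (@real_density (sigma_finite_copy slam)).
  apply/null_content_dominatesP => A mA; rewrite (_ : _ A = nu A + m A); last exact: lamE.
  move=> /eqP.
  by rewrite padde_eq0// => /andP[/eqP].
(* r = d nu / d (nu + m): the singular part of nu lives on [r = 1], and the
   density r / (1 - r) of nu with respect to m is bounded on each D n. *)
pose D n := [set x | (r x <= 1 - n.+1%:R^-1)%R].
pose E := [set x | (1 <= r x)%R].
have mD n : measurable (D n) by rewrite -[D n]setTI; exact: measurable_fun_le.
have mE : measurable E by rewrite -[E]setTI; exact: measurable_fun_le.
have mE0 : m E = 0.
  have := @integral_ge_cst lam r 1%R E mr ler01 mE (fun x Ex => Ex).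
  rewrite -rE// mul1e lamE -[leRHS]adde0 leeD2lE ?fin_num_measure// => mE0.
  by apply/eqP; rewrite eq_le mE0 measure_ge0.
have [n Dn] : exists n, 0 < nu (D n).
  apply: contrapT => D0; apply: nsing; exists E => //; split => //.
  apply/(negligibleP nu (measurableC mE)).
  apply: (@negligibleS _ _ _ _ (\bigcup_n D n)).
    move=> x /= /negP; rewrite -ltNge => /ltr_add_invr[n rn]; exists n => //.
    by rewrite /D /= lerBrDr ltW.
  apply: negligible_bigcup => n; apply/(negligibleP nu (mD n)).
  by apply: contrapT => nD; apply: D0; exists n; rewrite lt0e measure_ge0 andbT; apply/eqP.
(* With [N = n+1], the inequality [nu <= (1 - 1/N) (nu + m)] inside [D n] gives [nu <= (N - 1) m];
   the constant [N] is enough. *)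
exists (D n), n.+1%:R; split => // B mB.
have mBD : measurable (B `&` D n) by exact: measurableI.
have := @integral_le_cst lam r (1 - n.+1%:R^-1)%R _ mr r0 mBD (fun x Bx => Bx.2).
rewrite -rE// lamE => nuBD.
apply: (@le_trans _ _ (n.+1%:R%:E * m (B `&` D n))); last first.
  by rewrite lee_wpmul2l// le_measure ?inE.
move: nuBD; rewrite -(fineK (fin_num_measure nu _ mBD)).
have : 0 <= m (B `&` D n) by [].
move: (fine _) (m _) => p [y| |]//; last first.
  by move=> _ _; rewrite gt0_muley ?leey// lte_fin.
rewrite -EFinD -!EFinM !lee_fin => y0.
have : (n.+1%:R * n.+1%:R^-1 = 1 :> R)%R by rewrite divff.
have : (0 < n.+1%:R^-1 :> R)%R by rewrite invr_gt0.
have : (0 < n.+1%:R :> R)%R by [].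
move: (n.+1%:R^-1 : R)%R (n.+1%:R : R)%R => e N N0 e0 Ne ple.
rewrite -[leLHS]mul1r -Ne -mulrA ler_pM2l//; nra.
Qed.

Lemma bounded_density (m : {sigma_finite_measure set T -> \bar R})
    (nu : {finite_measure set T -> \bar R}) (C : R) : (0 <= C)%R ->
  (forall B, measurable B -> nu B <= C%:E * m B) ->
  exists f : T -> R, [/\ measurable_fun setT f, forall x, (0 <= f x <= C)%R &
    forall B, measurable B -> nu B = \int[m]_(x in B) (f x)%:E].
Proof.
move=> C0 nuC.
have [r [mr r0 rE]] : exists r : T -> R, [/\ measurable_fun setT r, forall x, (0 <= r x)%R &
    forall A, measurable A -> nu A = \int[m]_(x in A) (r x)%:E].
  apply: real_density; apply/null_content_dominatesP => A mA mA0.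
  by apply/eqP; rewrite eq_le measure_ge0 andbT (le_trans (nuC A mA))// mA0 mule0.
(* The hypothesis bounds the density by [C] almost everywhere only, since each [E j] is null.
   Truncation at [C] then gives a bound at every point. *)
pose E j := [set x | (C + j.+1%:R^-1 <= r x)%R].
have mE j : measurable (E j) by rewrite -[E j]setTI; exact: measurable_fun_le.
have mE0 j : m (E j) = 0.
  have e0 : (0 < j.+1%:R^-1 :> R)%R by rewrite invr_gt0.
  have : (C + j.+1%:R^-1)%:E * m (E j) <= nu (E j).
    by rewrite rE//; apply: integral_ge_cst => //; rewrite addr_ge0// ltW.
  have := nuC _ (mE j); rewrite -(fineK (fin_num_measure nu _ (mE j))).
  have : 0 <= m (E j) by [].
  move: (fine _) (m _) => p [y| |]//; last first.
    by move=> _ _; rewrite gt0_muley ?lte_fin ?ltr_wpDl//.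
  rewrite -!EFinM !lee_fin => y0 pC Cp; congr (_%:E); apply/eqP; rewrite eq_le y0 andbT.
  by move: e0 Cp; move: (_^-1)%R => e e0 Cp; rewrite -(pmulr_rle0 _ e0); lra.
exists (fun x => Num.min (r x) C); split.
- exact: measurable_minr.
- by move=> x; rewrite le_min r0 C0 ge_min lexx orbT.
move=> B mB; rewrite rE//; apply: ae_eq_integral => //.
- by apply/measurable_EFinP; exact: measurable_funS mr.
- by apply/measurable_EFinP; apply: measurable_minr => //; exact: measurable_funS mr.
have E0 : m.-negligible (\bigcup_j E j).
  by apply: negligible_bigcup => j; apply/(negligibleP m (mE j)); exact: mE0.
apply: negligibleS E0 => x /= /not_implyP[_ xC].
have : (C < r x)%R.
  by rewrite ltNge; apply/negP => rC; apply: xC; rewrite min_l.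
by move=> /ltr_add_invr[j /ltW]; exists j.
Qed.

End densities.

(** Each point has a basic open neighbourhood inside a compact set, so the countably many basic sets
    of finite measure already cover the group. *)
Lemma haar_sigma_finite (R : realType) (G : topologicalGroupType)
    (m : {measure set (borel G) -> \bar R}) :
  locally_compact [set: G] -> @second_countable G -> is_haar m ->
  sigma_finite setT m.
Proof.
move=> lc sc [_ mK _]; have [U [oU Ubase]] := countable_base sc.
exists (fun n => if pselect (m (U n) < +oo)%E then U n else set0); last first.
  move=> n; case: pselect => Un /=; last by rewrite measure0.
  by split => //; exact: borel_open.
apply/esym/seteqP; split => // x _.
have [K xK [cK clK]] := lc x I.
have : nbhs (x : G) [set y | [set: G] y -> K y] := xK.
rewrite nbhsE => -[V [oV Vx] VK].
have [n [Unx UV]] := Ubase V x oV Vx; exists n => //=.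
case: pselect => // -[]; apply: le_lt_trans (mK K cK).
apply: le_measure; rewrite ?inE.
- exact: borel_open.
- rewrite -[X in measurable X]setCK; apply: measurableC; apply: borel_open.
  exact: closed_openC.
- by move=> y /UV/VK; exact.
Qed.

Theorem theorem3p5 (R : realType) (G : topologicalGroupType)
    (G_hausdorff : hausdorff_space G)
    (G_locally_compact : locally_compact [set: G])
    (G_second_countable : @second_countable G)
    (m : {measure set (borel G) -> \bar R}) (m_haar : is_haar m)
    (mu : probability (borel G) R) (mu_spread_out : spread_out m mu) :
  exists mu' : probability (borel G) R,
    [/\ mu' `<< m, has_bounded_density m mu' & same_poisson_boundary mu mu'].
Proof.
have sm := haar_sigma_finite G_locally_compact G_second_countable m_haar.
have [_ _ m_inv] := m_haar.
have [theta [theta_harm theta_dom]] := geometric_mixture G_second_countable mu.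
have [D [C [mD C0 D0 thetaD]]] : exists D (C : R), [/\ measurable D, 0 <= C, (0 < theta D)%E &
    forall B, measurable B -> (theta (B `&` D) <= C%:E * m B)%E].
  (* A set witnessing that [theta] is singular would witness it for every positive power of [mu],
     since [theta] dominates them up to constants. *)
  apply: nonsingular_part => // -[A mA [mA0 thetaA]].
  have [[//|n] _ []] := mu_spread_out; exists A => //; split => //.
  have [t tE] := convolution_power_measure G_second_countable mu n.+1.
  have := theta_dom n _ (measurableC mA); rewrite thetaA mule0 tE => t0.
  by apply/eqP; rewrite eq_le t0 measure_ge0.
have mDC := measurableC mD.
(* [al] is the part of [theta] that lies below [C m]; its positive mass leaves [be] with mass below
   1, so the renewal series converges. *)
pose al : {finite_measure set (borel G) -> \bar R} := mrestr theta mD.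
pose be : {finite_measure set (borel G) -> \bar R} := mrestr theta mDC.
have thetaE B : measurable B -> theta B = (al B + be B)%E.
  by move=> mB; rewrite (measureDI theta mB mD) setDE addeC.
have al_gt0 : (0 < al setT)%E by rewrite /al /= /mrestr setTI.
have al_be : (al setT + be setT = 1)%E by rewrite -thetaE// probability_setT.
have [mu' [mu'E mu'_le]] := renewal_measure G_second_countable al_gt0 al_be.
have {}mu'_le := mu'_le m C C0 (fun B => measure_ge0 m B) m_inv thetaD.
exists mu'; split.
- apply/null_content_dominatesP => A mA mA0.
  by apply/eqP; rewrite eq_le measure_ge0 andbT (le_trans (mu'_le A mA))// mA0 mule0.
- have [|f [mf f0 fE]] := @bounded_density _ _ _ (sigma_finite_copy sm) mu' _ _ mu'_le.
    by rewrite divr_ge0// fine_ge0.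
  by exists f, (C / fine (al setT)).
- apply: (@same_poisson_boundary_harmonic _ _ G_second_countable mu mu'
    (bernoulli_measure mu) (bernoulli_measure mu')).
  + by move=> n B mB; exact: bernoulli_measure_prod.
  + by move=> n B mB; exact: bernoulli_measure_prod.
  + move=> f; rewrite -theta_harm; apply: iff_sym.
    exact: (harmonic_renewal G_second_countable thetaE mu'E al_gt0).
Qed.
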